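(* Let $\mathcal{D}$ be a symmetric $(15,8,4)$-design. The following assertions hold: (1) If $\mathcal{D}$ is of type (C2), then each of the actions of $\mathrm{Aut}(\mathcal{D})$ on the set of points and on the set of blocks has precisely two orbits, consisting of $3$ and $12$ elements. (2) If $\mathcal{D}$ is of type (C3), then each of the actions of $\mathrm{Aut}(\mathcal{D})$ on the set of points and on the set of blocks has precisely one fixed element and two further orbits, consisting of $6$ and $8$ elements. (3) If $\mathcal{D}$ is of type (C4), then the action of $\mathrm{Aut}(\mathcal{D})$ on the set of points has precisely two orbits, consisting of $7$ and $8$ elements; also, $\mathrm{Aut}(\mathcal{D})$ leaves one block fixed and acts transitively on the remaining blocks. (4) If $\mathcal{D}$ is of type (NC), then $\mathrm{Aut}(\mathcal{D})$ leaves one point fixed and acts transitively on the remaining points; the action of $\mathrm{Aut}(\mathcal{D})$ on the set of blocks has precisely two orbits, consisting of $7$ and $8$ elements.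
   Context: A symmetric $(15,8,4)$-design is an incidence structure of $15$ points and $15$ blocks such that each block consists of $8$ points and any two distinct blocks meet in precisely $4$ points. $\mathrm{Aut}(\mathcal{D})$ is the group of all bijections of the point set preserving the set of blocks. We take the point set to be $[15]=\{1,\dots,15\}$, so the set of blocks $\mathcal{B}$ consists of $8$-element subsets of $[15]$. $\mathcal{P}_4(15)$ is the point-line geometry whose points are all $8$-element subsets of $[15]$ and whose lines are the triples $\{X,Y,X\triangle Y\}$ of $8$-element subsets. Two distinct points $X,Y$ are collinear iff $|X\cap Y|=4$. The sets of blocks of symmetric $(15,8,4)$-designs on $[15]$ are precisely the $15$-cliques of the collinearity graph of $\mathcal{P}_4(15)$. A singular subspace is a set of pairwise collinear points containing the line through any two of its distinct points; maximal singular subspaces are isomorphic to $\mathrm{PG}(3,2)$. A Fano plane in $\mathcal{P}_4(15)$ is a singular subspace isomorphic to $\mathrm{PG}(2,2)$. Types of a design, according to its $15$-clique $\mathcal{B}$ of blocks: (C2) $\mathcal{B}$ is the union of three Fano planes through a common line, and a line of $\mathcal{P}_4(15)$ is contained in $\mathcal{B}$ iff it is a line of one of these Fano planes; (C3) $\mathcal{B}$ is the union of a Fano plane and four lines through a certain point of it, and a line of $\mathcal{P}_4(15)$ is contained in $\mathcal{B}$ iff it is a line of the Fano plane or one of these four lines; (C4) $\mathcal{B}$ is the union of seven lines through a point, and a line of $\mathcal{P}_4(15)$ is contained in $\mathcal{B}$ iff it is one of these seven lines; (NC) $\mathcal{B}$ is the union of a maximal singular subspace with a Fano plane deleted and a Fano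 plane disjoint from this subspace, and a line of $\mathcal{P}_4(15)$ is contained in $\mathcal{B}$ iff it is a line of the latter Fano plane. *)

(* Defs.v *)
From mathcomp Require Import all_boot all_fingroup all_algebra.

Set Implicit Arguments.
Unset Strict Implicit.
Unset Printing Implicit Defensive.

Record geometry (T : finType) := Geometry {
  points : {set T};
  lines : {set {set T}}
}.

Definition collinear (T : finType) (G : geometry T) (x y : T) : bool :=
  [exists L in lines G, (x \in L) && (y \in L)].

Definition singular (T : finType) (G : geometry T) (S : {set T}) : Prop :=
  [/\ S \subset points G,
      {in S &, forall x y, x != y -> collinear G x y}
    & {in S &, forall x y, x != y -> forall L, L \in lines G ->
         x \in L -> y \in L -> L \subset S}].

Definition max_singular (T : finType) (G : geometry T) (S : {set T}) : Prop :=
  singular G S /\ forall S', singular G S' -> S \subset S' -> S' = S.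

Definition subgeometry (T : finType) (G : geometry T) (S : {set T}) :=
  Geometry (points G :&: S) [set L in lines G | L \subset S].

Definition geometry_iso (T1 T2 : finType) (G1 : geometry T1)
    (G2 : geometry T2) : Prop :=
  exists f : T1 -> T2,
    [/\ {in points G1 &, injective f},
        f @: points G1 = points G2
      & forall L : {set T1}, L \subset points G1 ->
          (L \in lines G1) = (f @: L \in lines G2)].

(* The projective space PG(n, 2): its points are the 1-dimensional subspaces  *)
(* of F_2^(n+1), each represented by the canonical matrix <<v>> of its row    *)
(* space; its lines are the sets of points lying in a 2-dimensional subspace. *)
Definition PG2_points (n : nat) : {set 'M['F_2]_n.+1} :=
  [set <<v>>%MS | v : 'rV['F_2]_n.+1 & v != 0%R].

Definition PG2 (n : nat) : geometry 'M['F_2]_n.+1 :=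
  Geometry (PG2_points n)
    [set [set p in PG2_points n | (p <= M)%MS]
       | M : 'M['F_2]_(2, n.+1) & \rank M == 2].

Definition fano_plane (T : finType) (G : geometry T) (S : {set T}) : Prop :=
  singular G S /\ geometry_iso (subgeometry G S) (PG2 2).

Definition symdiff (T : finType) (X Y : {set T}) : {set T} :=
  (X :\: Y) :|: (Y :\: X).

(* The set {1, ..., 15} is represented by 'I_15. For X, Y and their symmetric  *)
(* difference of size 8, the three sets are automatically distinct.           *)
Definition P4_points : {set {set 'I_15}} := [set X : {set 'I_15} | #|X| == 8].

Definition P4 : geometry {set 'I_15} :=
  Geometry P4_points
    [set [set X; Y; symdiff X Y]
       | X in P4_points, Y in P4_points & symdiff X Y \in P4_points].

(* A symmetric (15,8,4)-design is given by its set of blocks.                 *)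
Definition design_15_8_4 (B : {set {set 'I_15}}) : Prop :=
  [/\ #|B| = 15,
      {in B, forall X : {set 'I_15}, #|X| = 8}
    & {in B &, forall X Y : {set 'I_15}, X != Y -> #|X :&: Y| = 4}].

(* The setwise stabiliser of B under the action 'P^* on sets of points.       *)
Definition design_aut (B : {set {set 'I_15}}) : {group {perm 'I_15}} :=
  [group of 'N(B | 'P^* )%g].

Definition type_C2 (B : {set {set 'I_15}}) : Prop :=
  exists (K : {set {set 'I_15}}) (Fs : {set {set {set 'I_15}}}),
    [/\ K \in lines P4,
        #|Fs| = 3,
        {in Fs, forall F : {set {set 'I_15}}, fano_plane P4 F /\ K \subset F},
        B = cover Fs
      & {in lines P4, forall L : {set {set 'I_15}},
           L \subset B <-> exists2 F, F \in Fs & L \subset F}].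

Definition type_C3 (B : {set {set 'I_15}}) : Prop :=
  exists (F : {set {set 'I_15}}) (X : {set 'I_15})
      (Ls : {set {set {set 'I_15}}}),
    [/\ fano_plane P4 F /\ X \in F,
        #|Ls| = 4,
        {in Ls, forall L : {set {set 'I_15}}, L \in lines P4 /\ X \in L},
        B = F :|: cover Ls
      & {in lines P4, forall L : {set {set 'I_15}},
           L \subset B <-> L \subset F \/ L \in Ls}].

Definition type_C4 (B : {set {set 'I_15}}) : Prop :=
  exists (X : {set 'I_15}) (Ls : {set {set {set 'I_15}}}),
    [/\ #|Ls| = 7,
        {in Ls, forall L : {set {set 'I_15}}, L \in lines P4 /\ X \in L},
        B = cover Ls
      & {in lines P4, forall L : {set {set 'I_15}},
           L \subset B <-> L \in Ls}].

Definition type_NC (B : {set {set 'I_15}}) : Prop :=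
  exists M F F' : {set {set 'I_15}},
    [/\ max_singular P4 M,
        fano_plane P4 F /\ F \subset M,
        fano_plane P4 F' /\ [disjoint F' & M],
        B = (M :\: F) :|: F'
      & {in lines P4, forall L : {set {set 'I_15}},
           L \subset B <-> L \subset F'}].

(* In the following definitions S is meant to be invariant under A.           *)
Definition orbits (aT : finGroupType) (D : {set aT}) (rT : finType)
    (to : action D rT) (A : {set aT}) (S : {set rT}) : {set {set rT}} :=
  orbit to A @: S.

Definition two_orbits (aT : finGroupType) (D : {set aT}) (rT : finType)
    (to : action D rT) (A : {set aT}) (S : {set rT}) (m n : nat) : Prop :=
  exists O1 O2 : {set rT},
    [/\ orbits to A S = [set O1; O2], O1 != O2, #|O1| = m & #|O2| = n].

Definition fixed_and_two_orbits (aT : finGroupType) (D : {set aT})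
    (rT : finType) (to : action D rT) (A : {set aT}) (S : {set rT})
    (m n : nat) : Prop :=
  exists x : rT,
    'Fix_(S | to)(A)%g = [set x] /\ two_orbits to A (S :\ x) m n.

Definition fixed_and_transitive (aT : finGroupType) (D : {set aT})
    (rT : finType) (to : action D rT) (A : {set aT}) (S : {set rT}) : Prop :=
  exists x : rT,
    'Fix_(S | to)(A)%g = [set x] /\ [transitive A, on S :\ x | to]%g.

(* Main.v *)
Require Import Defs.
From mathcomp Require Import all_boot all_fingroup all_algebra.
From mathcomp Require Import zify.

(* In the types (C2), (C3), (C4) some block X is a centre: X + Y is a block   *)
(* for every other block Y, where + is the symmetric difference. Any two      *)
(* points are separated by exactly 8 of the 15 blocks, so some block Y3       *)
(* separates both the two points of X, Y1, Y2 and the two points of Y1, Y2    *)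
(* outside X; the incidences with X, Y1, Y2, Y3 then identify the points with *)
(* the nonzero vectors of F_2^4. In type (NC) the same identification comes   *)
(* from a basis of the singular subspace, three of whose members span the     *)
(* deleted Fano plane. In these coordinates the remaining blocks form a       *)
(* clique in an explicit list of candidates, which leaves 24 designs for the  *)
(* first three types and, without those meeting the deleted plane, 8 designs  *)
(* for the last one. For a block X let c(X) be the number of blocks Y such    *)
(* that X + Y is a block, and for a point p let w(p) be the sum of c(X) over  *)
(* the blocks X through p. Both are invariant under automorphisms, the type   *)
(* determines the values of c, and explicit automorphisms show that the level *)
(* sets of c and w are single orbits.                                         *)

(** * Symmetric differences and singular subspaces *)

(** Each type of design leaves, after a suitable labelling of the points, only finitely many
    explicit block sets, and on each of them the orbits are the level sets of an integer invariant.
    Invariance makes every level set a union of orbits; listed automorphisms make it a single orbit.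

    Labelling rests on [frame_labelling]: four blocks whose Venn cells inside their union are
    singletons serve as coordinate functions on the nonzero vectors of F_2^4. [centred_labelling]
    and [affine_labelling] find such blocks, [design_completion] places the design in a computed
    list, and [centred_completions] and [affine_completions] check that list. The lemmas
    [type_C2_sum_counts], [type_C3_sum_counts] and [type_C4_sum_counts] then tell the centred types
    apart, because the type prescribes how many lines of [P4] inside the design pass through a
    block. *)

Lemma in_symdiff {T : finType} (X Y : {set T}) x :
  (x \in symdiff X Y) = (x \in X) (+) (x \in Y).
Proof. by rewrite !inE; case: (x \in X); case: (x \in Y). Qed.

Lemma symdiffC {T : finType} (X Y : {set T}) : symdiff X Y = symdiff Y X.
Proof. by apply/setP=> x; rewrite !in_symdiff addbC. Qed.

Lemma symdiffv {T : finType} (X : {set T}) : symdiff X X = set0.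
Proof. by apply/setP=> x; rewrite in_symdiff addbb inE. Qed.

Lemma symdiffK {T : finType} (X Y : {set T}) : symdiff X (symdiff X Y) = Y.
Proof. by apply/setP=> x; rewrite !in_symdiff addKb. Qed.

Lemma symdiffKr {T : finType} (X Y : {set T}) : symdiff (symdiff X Y) Y = X.
Proof. by apply/setP=> x; rewrite !in_symdiff addbK. Qed.

Lemma symdiff_eq {T : finType} (X Y Z : {set T}) :
  (symdiff X Y == Z) = (Y == symdiff X Z).
Proof. by apply/eqP/eqP=> [<- | ->]; rewrite symdiffK. Qed.

Lemma imset_symdiff {T : finType} (s : {perm T}) (X Y : {set T}) :
  s @: symdiff X Y = symdiff (s @: X) (s @: Y).
Proof.
apply/setP=> x; rewrite -[x](permKV s) in_symdiff !mem_imset ?in_symdiff //;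
  exact: perm_inj.
Qed.

Lemma card_setI_symdiff {T : finType} (X Y Z : {set T}) :
  #|Z :&: symdiff X Y| + 2 * #|X :&: Y :&: Z| = #|X :&: Z| + #|Y :&: Z|.
Proof.
have -> : Z :&: symdiff X Y = (Z :&: X) :\: Y :|: (Z :&: Y) :\: X.
  by apply/setP=> x; rewrite !inE; case: (x \in X); case: (x \in Y);
     rewrite ?andbF ?andbT ?orbF.
rewrite cardsU.
have -> : ((Z :&: X) :\: Y) :&: ((Z :&: Y) :\: X) = set0.
  by apply/setP=> x; rewrite !inE; case: (x \in X); case: (x \in Y);
     rewrite ?andbF ?andbT.
have := cardsID Y (Z :&: X); have := cardsID X (Z :&: Y).
rewrite cards0 (setIC X Z) (setIC Y Z) -!setIA (setIC Y X) !setIA.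
rewrite (setIC (X :&: Y) Z) !setIA; lia.
Qed.

(** This is how closure under symmetric difference pins down triple and quadruple intersections once
    the smaller ones are known. *)
Lemma card_setI_half {T : finType} {X Y Z : {set T}} (m : nat) :
    #|X :&: Z| = m -> #|Y :&: Z| = m -> #|Z :&: symdiff X Y| = m ->
  #|X :&: Y :&: Z| = m./2.
Proof.
move=> cXZ cYZ cXYZ; have := card_setI_symdiff X Y Z; rewrite cXZ cYZ cXYZ.
move: #|_ :&: _| => k; lia.
Qed.

Lemma card_symdiff {T : finType} (X Y : {set T}) :
  #|symdiff X Y| + 2 * #|X :&: Y| = #|X| + #|Y|.
Proof. by have := card_setI_symdiff X Y setT; rewrite setTI !setIT. Qed.

Lemma P4_line (X Y : {set 'I_15}) :
    X \in P4_points -> Y \in P4_points -> symdiff X Y \in P4_points ->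
  [set X; Y; symdiff X Y] \in lines P4.
Proof.
move=> hX hY hXY; apply: imset2_f => //; first by rewrite inE hY.
Qed.

Lemma P4_line_symdiff {L : {set {set 'I_15}}} {X Y : {set 'I_15}} :
  L \in lines P4 -> X \in L -> Y \in L -> X != Y -> symdiff X Y \in L.
Proof.
case/imset2P=> U V _ _ ->; rewrite !inE -!orbA.
move=> /or3P[]/eqP-> /or3P[]/eqP->; rewrite ?eqxx //= => _;
  rewrite ?symdiffK ?symdiffKr ?[symdiff V U]symdiffC ?eqxx ?orbT //.
- by rewrite [symdiff V _]symdiffC symdiffKr eqxx.
- by rewrite [symdiff _ U]symdiffC symdiffK eqxx orbT.
Qed.

Lemma singular_symdiff {S : {set {set 'I_15}}} {X Y : {set 'I_15}} :
  singular P4 S -> X \in S -> Y \in S -> X != Y -> symdiff X Y \in S.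
Proof.
case=> _ hcol hline hX hY nXY.
have /exists_inP[L hL /andP[XL YL]] := hcol X Y hX hY nXY.
exact: subsetP (hline X Y hX hY nXY L hL XL YL) _ (P4_line_symdiff hL XL YL nXY).
Qed.

Lemma singular_card {S : {set {set 'I_15}}} {X : {set 'I_15}} :
  singular P4 S -> X \in S -> #|X| = 8.
Proof. by case=> /subsetP hS _ _ /hS; rewrite inE => /eqP. Qed.

Lemma singular_cardI {S : {set {set 'I_15}}} {X Y : {set 'I_15}} :
  singular P4 S -> X \in S -> Y \in S -> X != Y -> #|X :&: Y| = 4.
Proof.
move=> hS hX hY nXY; have := card_symdiff X Y.
rewrite (singular_card hS hX) (singular_card hS hY).
rewrite (singular_card hS (singular_symdiff hS hX hY nXY)); lia.
Qed.

Lemma card_PG2_points n : #|PG2_points n| = (2 ^ n.+1).-1.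
Proof.
rewrite card_in_imset => [|v w].
  have <- : #|{: 'rV['F_2]_n.+1}| = 2 ^ n.+1 by rewrite card_mx mul1n card_Fp.
  rewrite -(cardC1 (0%R : 'rV['F_2]_n.+1)).
  by apply: eq_card => v; rewrite !inE.
rewrite !inE => nzv nzw eq_vw.
(* Vectors with the same row space are proportional, and the only nonzero scalar of F_2 is 1. *)
have /sub_rVP[a def_v] : (v <= w)%MS.
  by rewrite -(genmxE v) eq_vw genmxE.
move: nzv; rewrite def_v GRing.scaler_eq0 negb_or => /andP[nza _].
suff -> : a = 1%R by rewrite GRing.scale1r.
by case: a nza {def_v} => [[|[|//]] lt_a2] // _; apply: val_inj.
Qed.

Lemma card_fano_plane {F : {set {set 'I_15}}} : fano_plane P4 F -> #|F| = 7.
Proof.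
case=> [[hF _ _]] [f [injf imf _]]; move/(congr1 (fun A => #|pred_of_set A|)): imf.
by rewrite card_in_imset //= (setIidPr hF) card_PG2_points.
Qed.

(** * Designs in coordinates *)

Definition meet (b c : bitseq) : bitseq := [seq x.1 && x.2 | x <- zip b c].

Definition xor (b c : bitseq) : bitseq := [seq x.1 (+) x.2 | x <- zip b c].

Definition weight (b : bitseq) : nat := count id b.

Lemma weight_meet_le b c : weight (meet b c) <= weight c.
Proof.
by elim: b c => [|x b IHb] [|y c] //=; apply: leq_add (IHb c); case: x y => [] [].
Qed.

Lemma nth_meet b c i : size b = size c ->
  nth false (meet b c) i = nth false b i && nth false c i.
Proof.
move=> eq_sz; have [lti | lei] := ltnP i (size b).
  by rewrite (nth_map (false, false)) ?nth_zip // size_zip -eq_sz minnn.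
by rewrite !nth_default // ?size_map ?size_zip -eq_sz ?minnn.
Qed.

Lemma nth_xor b c i : size b = size c ->
  nth false (xor b c) i = nth false b i (+) nth false c i.
Proof.
move=> eq_sz; have [lti | lei] := ltnP i (size b).
  by rewrite (nth_map (false, false)) ?nth_zip // size_zip -eq_sz minnn.
by rewrite !nth_default // ?size_map ?size_zip -eq_sz ?minnn.
Qed.

Lemma size_meet b c : size b = size c -> size (meet b c) = size b.
Proof. by move=> eq_sz; rewrite size_map size_zip -eq_sz minnn. Qed.

Lemma size_xor b c : size b = size c -> size (xor b c) = size b.
Proof. by move=> eq_sz; rewrite size_map size_zip -eq_sz minnn. Qed.

(** A constraint [(c, k)] asks for exactly [k] ones inside the mask [c]. A branch is cut when [k]
    exceeds the ones left in the mask; the second guard keeps the truncated subtraction from hiding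
    a one too many. *)
Fixpoint solve (n : nat) (cs : seq (bitseq * nat)) : seq bitseq :=
  if n is n'.+1 then
    let next x :=
      [seq x :: b | b <- solve n' [seq (behead c.1, c.2 - (x && head false c.1))
                                  | c <- cs]] in
    if all (fun c => c.2 <= weight c.1) cs then
      next false ++
      (if all (fun c => head false c.1 ==> (0 < c.2)) cs then next true else [::])
    else [::]
  else if all (fun c => c.2 == 0) cs then [:: [::]] else [::].

Lemma mem_solve n cs b : size b = n ->
  all (fun c => weight (meet b c.1) == c.2) cs -> b \in solve n cs.
Proof.
elim: n cs b => [|n IHn] cs [|x b] //= => [_ hb | [sz_b] hb].
  by rewrite (_ : all _ cs) //; apply: sub_all hb => -[[|? ?] k] /eqP <-.
have step : all (fun c => weight (meet b c.1) == c.2)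
    [seq (behead c.1, c.2 - (x && head false c.1)) | c <- cs].
  rewrite all_map; apply: sub_all hb => -[[|y c] k] /=.
    by case: b {sz_b} => [|? ?]; rewrite andbF subn0.
  by rewrite /weight /= => /eqP <-; rewrite addKn.
have -> : all (fun c => c.2 <= weight c.1) cs.
  by apply: sub_all hb => c /eqP <-; apply: weight_meet_le (x :: b) _.
rewrite mem_cat; case: x hb step => hb step; last by rewrite map_f ?IHn.
rewrite [all _ cs](_ : _ = true); first by rewrite map_f ?orbT ?IHn.
by apply: sub_all hb => -[[|[] c] k] //= /eqP <-.
Qed.

Fixpoint cliques {T : Type} (r : rel T) (n : nat) (s : seq T) : seq (seq T) :=
  if n is n'.+1 then
    (fix from s := if s is x :: s' then
       [seq x :: c | c <- cliques r n' [seq y <- s' | r x y]] ++ from s'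
     else [::]) s
  else [:: [::]].

Lemma mem_cliques {T : eqType} (r : rel T) (s c : seq T) :
  subseq c s -> pairwise r c -> c \in cliques r (size c) s.
Proof.
elim: c s => [|x c IHc] //=; elim=> [|y s IHs] //=.
move=> sub_cs /andP[rxc rc]; rewrite mem_cat.
case: eqP sub_cs => [<- sub_cs | _ sub_cs]; last by rewrite IHs ?orbT ?rxc.
by rewrite map_f // IHc // subseq_filter rxc.
Qed.

(** * Blocks as bit sequences under a labelling of the points *)

Definition blk (s : {perm 'I_15}) (b : bitseq) : {set 'I_15} :=
  [set p | nth false b (s p)].

Lemma blk_onto s (X : {set 'I_15}) : exists2 b, size b = 15 & X = blk s b.
Proof.
exists (mkseq (fun i => (s^-1)%g (inord i) \in X) 15); first by rewrite size_mkseq.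
by apply/setP=> p; rewrite inE nth_mkseq // inord_val permK.
Qed.

Lemma blk_inj s b c : size b = 15 -> size c = 15 -> blk s b = blk s c -> b = c.
Proof.
move=> sz_b sz_c /setP eq_bc; apply: (@eq_from_nth _ false); first by rewrite sz_b.
rewrite sz_b => i lti; have := eq_bc ((s^-1)%g (Ordinal lti)).
by rewrite !inE permKV.
Qed.

Lemma blkI s b c : size b = 15 -> size c = 15 ->
  blk s b :&: blk s c = blk s (meet b c).
Proof. by move=> sz_b sz_c; apply/setP=> p; rewrite !inE nth_meet ?sz_b. Qed.

Lemma symdiff_blk s b c : size b = 15 -> size c = 15 ->
  symdiff (blk s b) (blk s c) = blk s (xor b c).
Proof.
by move=> sz_b sz_c; apply/setP=> p; rewrite in_symdiff !inE nth_xor ?sz_b.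
Qed.

Lemma card_blk s b : size b = 15 -> #|blk s b| = weight b.
Proof.
move=> sz_b.
have -> : blk s b = s @^-1: [set i : 'I_15 | nth false b i].
  by apply/setP=> p; rewrite !inE.
rewrite card_preimset; last exact: perm_inj.
rewrite -sum1_card (eq_bigl (fun i : 'I_15 => nth false b i)); last first.
  by move=> i; rewrite inE.
rewrite -(big_mkord (fun i => nth false b i) (fun=> 1)) -sz_b.
by rewrite -(big_nth false id (fun=> 1)) sum1_count.
Qed.

(* The point of 'I_15 labelled i corresponds to the nonzero vector of F_2^4   *)
(* with binary digits i + 1, and [digit k] is the k-th coordinate function.   *)
Definition digit (k : nat) : bitseq :=
  [seq odd (iter k half i.+1) | i <- iota 0 15].

(** Applied to the code of a point's Venn cell, this turns every intersection size into a linear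
    expression in the cell sizes. *)
Lemma card_preim_code {T : finType} (f : T -> nat) (n : nat) (a : pred nat) :
    (forall x, f x < n) ->
  #|[set x | a (f x)]| =
  sumn [seq #|[set x | f x == v]| | v <- [seq v <- iota 0 n | a v]].
Proof.
move=> ltn_f; rewrite sumnE big_map big_filter -sum1_card.
rewrite [RHS](eq_bigr (fun v => \sum_(x | f x == v) 1)); last first.
  by move=> v _; rewrite -sum1_card; apply: eq_bigl => x; rewrite inE.
rewrite (exchange_big_dep predT) //= (eq_bigl (fun x => a (f x))); last first.
  by move=> x; rewrite inE.
rewrite big_mkcond; apply: eq_bigr => x _.
rewrite [RHS]big_mkcond (bigD1_seq (f x)) ?iota_uniq ?mem_iota //=.
rewrite eqxx ?andbT big1 ?addn0 // => v /negPf ne_v.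
by rewrite eq_sym ne_v andbF.
Qed.

(** The fifteen given sizes and the total of 15 points are sixteen independent linear equations for
    the sixteen Venn cells. Their solution has the outer cell empty and every other cell a
    singleton, so the cell code is a bijection onto 1, ..., 15. *)
Lemma frame_labelling (X0 X1 X2 X3 : {set 'I_15}) :
    #|X0| = 8 -> #|X1| = 8 -> #|X2| = 8 -> #|X3| = 8 ->
    #|X0 :&: X1| = 4 -> #|X0 :&: X2| = 4 -> #|X0 :&: X3| = 4 ->
    #|X1 :&: X2| = 4 -> #|X1 :&: X3| = 4 -> #|X2 :&: X3| = 4 ->
    #|X0 :&: X1 :&: X2| = 2 -> #|X0 :&: X1 :&: X3| = 2 ->
    #|X0 :&: X2 :&: X3| = 2 -> #|X1 :&: X2 :&: X3| = 2 ->
    #|X0 :&: X1 :&: X2 :&: X3| = 1 ->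
  exists s, [/\ X0 = blk s (digit 0), X1 = blk s (digit 1),
                X2 = blk s (digit 2) & X3 = blk s (digit 3)].
Proof.
pose f p := (p \in X0) + 2 * ((p \in X1) + 2 * ((p \in X2) + 2 * (p \in X3))).
have ltf p : f p < 16.
  by rewrite /f; do 4![case: (_ \in _)].
pose dg k v := odd (iter k half v).
have digP p : [/\ (p \in X0) = dg 0 (f p), (p \in X1) = dg 1 (f p),
                  (p \in X2) = dg 2 (f p) & (p \in X3) = dg 3 (f p)].
  by rewrite /f; do 4![case: (_ \in _)].
have [N defN] : exists N : nat -> nat, forall v, #|[set p | f p == v]| = N v.
  by exists (fun v => #|[set p | f p == v]|).
have cardP (A : {set 'I_15}) (a : pred nat) : (forall p, p \in A = a (f p)) ->
  #|A| = sumn [seq N v | v <- [seq v <- iota 0 16 | a v]].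
  move=> eqA; rewrite -(eq_map defN) -(card_preim_code f 16 a ltf).
  by congr #|pred_of_set _|; apply/setP=> p; rewrite eqA inE.
rewrite (cardP X0 (dg 0)) ?(cardP X1 (dg 1)) ?(cardP X2 (dg 2))
  ?(cardP X3 (dg 3)); try by move=> p; case: (digP p).
rewrite (cardP (X0 :&: X1) (fun v => dg 0 v && dg 1 v))
  ?(cardP (X0 :&: X2) (fun v => dg 0 v && dg 2 v))
  ?(cardP (X0 :&: X3) (fun v => dg 0 v && dg 3 v))
  ?(cardP (X1 :&: X2) (fun v => dg 1 v && dg 2 v))
  ?(cardP (X1 :&: X3) (fun v => dg 1 v && dg 3 v))
  ?(cardP (X2 :&: X3) (fun v => dg 2 v && dg 3 v))
  ?(cardP (X0 :&: X1 :&: X2) (fun v => [&& dg 0 v, dg 1 v & dg 2 v]))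
  ?(cardP (X0 :&: X1 :&: X3) (fun v => [&& dg 0 v, dg 1 v & dg 3 v]))
  ?(cardP (X0 :&: X2 :&: X3) (fun v => [&& dg 0 v, dg 2 v & dg 3 v]))
  ?(cardP (X1 :&: X2 :&: X3) (fun v => [&& dg 1 v, dg 2 v & dg 3 v]))
  ?(cardP (X0 :&: X1 :&: X2 :&: X3)
      (fun v => [&& dg 0 v, dg 1 v, dg 2 v & dg 3 v]));
  try by move=> p; case: (digP p) => e0 e1 e2 e3; rewrite !inE -?andbA ?e0 ?e1 ?e2 ?e3.
have := cardP setT predT (fun=> in_setT _).
rewrite cardsT card_ord /=.
move=> *.
have /allP N1 : all (fun v => N v == (v != 0)) (iota 0 16) by rewrite /=; lia.
have cardf p : #|[set q | f q == f p]| = (f p != 0).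
  by rewrite defN; apply/eqP/N1; rewrite mem_iota ltf.
have f_gt0 p : 0 < f p.
  by case: posnP (cardf p) => // f0 /eqP; rewrite cards_eq0 => /eqP/setP/(_ p);
    rewrite !inE eqxx.
have injf : injective f.
  move=> p q eq_f; have /eqP := cardf p; rewrite -lt0n f_gt0 => /cards1P[r def_r].
  have [] : p \in [set r] /\ q \in [set r] by rewrite -def_r !inE eq_f eqxx.
  by rewrite !inE => /eqP-> /eqP->.
(* The label is the code minus one, matching the shift in [digit]. *)
have g_val p : (inord (f p).-1 : 'I_15).+1 = f p.
  by rewrite inordK ?prednK //; have := ltf p; have := f_gt0 p; lia.
have injg : injective (fun p => inord (f p).-1 : 'I_15).
  by move=> p q /(congr1 (fun i : 'I_15 => i.+1)); rewrite !g_val => /injf.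
have nth_digit k p : nth false (digit k) (perm injg p) = dg k (f p).
  by rewrite permE (nth_map 0) ?size_iota // nth_iota // add0n g_val.
by exists (perm injg); split; apply/setP=> p; rewrite inE nth_digit;
  case: (digP p).
Qed.

(** * Completing a partial list of blocks to a design *)

Definition blocks s (D : seq bitseq) : {set {set 'I_15}} :=
  [set:: [seq blk s b | b <- D]].

Lemma mem_blocks s D b : size b = 15 -> all (fun c => size c == 15) D ->
  (blk s b \in blocks s D) = (b \in D).
Proof.
move=> sz_b /allP sz_D; rewrite inE; apply/mapP/idP => [[c Dc eq_bc]|Db].
  by rewrite (blk_inj s b c sz_b (eqP (sz_D c Dc)) eq_bc).
by exists b.
Qed.

Lemma card_blocks s D : all (fun c => size c == 15) D -> uniq D ->
  #|blocks s D| = size D.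
Proof.
move=> /allP sz_D uD; rewrite cardsE (card_uniqP _) ?size_map //.
by rewrite map_inj_in_uniq // => b c /sz_D/eqP sz_b /sz_D/eqP sz_c; apply: blk_inj.
Qed.

Definition candidates (K : seq bitseq) : seq bitseq :=
  solve 15 ((nseq 15 true, 8) :: [seq (b, 4) | b <- K]).

Definition completions (K : seq bitseq) : seq (seq bitseq) :=
  [seq K ++ c | c <- cliques (fun b c => weight (meet b c) == 4) (15 - size K)
                       (candidates K)].

Lemma meet_nseq b : meet b (nseq (size b) true) = b.
Proof. by elim: b => //= x b IHb; rewrite -[in RHS]IHb /meet /= andbT. Qed.

(** Every block outside [K] has 8 points and meets each member of [K] in 4, so it is a candidate;
    any two of these blocks meet in 4 points, so together they form a clique of size
    [15 - size K]. *)
Lemma design_completion s (B : {set {set 'I_15}}) (K : seq bitseq) :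
    design_15_8_4 B -> all (fun b => size b == 15) (K ++ candidates K) ->
    uniq (K ++ candidates K) -> all (fun b => blk s b \in B) K ->
  exists2 D, D \in completions K & B = blocks s D.
Proof.
case=> cardB card8 card4 sz_KC uKC /allP KB.
have weight4 b1 b2 : size b1 = 15 -> size b2 = 15 -> blk s b1 \in B ->
    blk s b2 \in B -> b1 != b2 -> weight (meet b1 b2) = 4.
  move=> sz1 sz2 B1 B2 ne12; rewrite -(card_blk s) ?size_meet ?sz1 // -blkI //.
  by apply: card4 => //; apply: contraNneq ne12 => /blk_inj->.
have memC b : size b = 15 -> blk s b \in B -> b \notin K -> b \in candidates K.
  move=> sz_b bB bK; apply: mem_solve => //; apply/allP=> x.
  rewrite inE => /predU1P[-> | /mapP[k kK ->]].
    change (weight (meet b (nseq 15 true)) == 8).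
    by rewrite -[X in nseq X _]sz_b meet_nseq -(card_blk s) // card8.
  apply/eqP/weight4 => //=.
  - by apply/eqP; apply: (allP sz_KC); rewrite mem_cat kK.
  - exact: KB.
  - by apply: contraNneq bK => ->.
rewrite /completions; move: (candidates K) sz_KC uKC memC => C.
rewrite all_cat cat_uniq => /andP[sz_K /allP sz_C] /and3P[uK /hasPn KC' uC] memC.
pose c := [seq b <- C | blk s b \in B].
have sz_c : all (fun b => size b == 15) c.
  by apply/allP=> b; rewrite mem_filter => /andP[_ /sz_C].
have sz_Kc : all (fun b => size b == 15) (K ++ c) by rewrite all_cat sz_K.
have uc : uniq c by apply: filter_uniq.
have uKc : uniq (K ++ c).
  rewrite cat_uniq uK uc andbT /=; apply/hasPn=> b.
  by rewrite mem_filter => /andP[_ /KC'].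
have defB : B = blocks s (K ++ c).
  apply/setP=> X; have [b sz_b ->] := blk_onto s X; rewrite mem_blocks //.
  rewrite mem_cat mem_filter; apply/idP/idP=> [bB | /orP[/KB//|/andP[]//]].
  by rewrite bB /=; have [//|bK] := boolP (b \in K); apply: memC.
exists (K ++ c) => //; apply: map_f.
have <- : size c = 15 - size K.
  by rewrite -cardB defB card_blocks // size_cat addKn.
apply: mem_cliques; first exact: filter_subseq.
move: uc; rewrite uniq_pairwise; apply: (@sub_in_pairwise _ (mem c)); last exact/allP.
move=> b1 b2 cb1 cb2 ne12.
have [B1 B2] : blk s b1 \in B /\ blk s b2 \in B.
  by move: cb1 cb2; rewrite !mem_filter => /andP[-> _] /andP[-> _].
by rewrite weight4 //; apply/eqP; apply: (allP sz_c).
Qed.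

(** * Orbits as level sets of an invariant *)

(** Keeping the values as a multiset [vs] lets orbit sizes be read off as multiplicities. *)
Definition level_orbits {aT : finGroupType} {rT : finType}
    (to : {action aT &-> rT}) (A : {set aT}) (S : {set rT}) (f : rT -> nat)
    (vs : seq nat) : Prop :=
  [/\ perm_eq [seq f x | x in S] vs,
      forall a x, a \in A -> x \in S -> to x a \in S /\ f (to x a) = f x
    & {in S &, forall x y, f x = f y -> y \in orbit to A x}].

Lemma card_level {aT : finGroupType} {rT : finType} {to : {action aT &-> rT}}
    {A : {set aT}} {S : {set rT}} {f : rT -> nat} {vs : seq nat} (v : nat) :
  level_orbits to A S f vs -> #|[set x in S | f x == v]| = count_mem v vs.
Proof.
case=> /seq.permP <- _ _; rewrite count_map -size_filter cardE.
rewrite /enum_mem -filter_predI; congr size; apply: eq_filter => x.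
by rewrite !inE andbC.
Qed.

Lemma level_mem {aT : finGroupType} {rT : finType} {to : {action aT &-> rT}}
    {A : {set aT}} {S : {set rT}} {f : rT -> nat} {vs : seq nat} {x : rT} :
  level_orbits to A S f vs -> x \in S -> f x \in vs.
Proof.
by case=> /perm_mem <- _ _ Sx; apply/mapP; exists x; rewrite ?mem_enum.
Qed.

Lemma level_onto {aT : finGroupType} {rT : finType} {to : {action aT &-> rT}}
    {A : {set aT}} {S : {set rT}} {f : rT -> nat} {vs : seq nat} {v : nat} :
  level_orbits to A S f vs -> v \in vs -> exists2 x, x \in S & f x = v.
Proof.
by case=> /perm_mem <- _ _ /mapP[x Sx ->]; exists x => //; move: Sx; rewrite mem_enum.
Qed.

Lemma orbit_level {aT : finGroupType} {rT : finType} {to : {action aT &-> rT}}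
    {A : {set aT}} {S : {set rT}} {f : rT -> nat} {vs : seq nat} {x : rT} :
  level_orbits to A S f vs -> x \in S ->
  orbit to A x = [set y in S | f y == f x].
Proof.
case=> _ inv tr Sx; apply/setP=> y; rewrite inE; apply/idP/andP.
  by case/imsetP=> a Aa ->; have [-> ->] := inv a x Aa Sx.
by case=> Sy /eqP eq_f; apply: tr.
Qed.

Lemma count_mem_nseq2 (u v m n : nat) : u != v ->
  count_mem u (nseq m u ++ nseq n v) = m /\
  count_mem v (nseq m u ++ nseq n v) = n.
Proof.
move=> ne_uv; rewrite !count_cat !count_nseq /= !eqxx (negPf ne_uv).
by rewrite eq_sym (negPf ne_uv) !mul1n addn0.
Qed.

Lemma level_two_orbits {aT : finGroupType} {rT : finType}
    {to : {action aT &-> rT}} {A : {set aT}} {S : {set rT}} {f : rT -> nat}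
    {u v m n : nat} :
    u != v -> 0 < m -> 0 < n ->
  level_orbits to A S f (nseq m u ++ nseq n v) -> two_orbits to A S m n.
Proof.
move=> ne_uv m_gt0 n_gt0 lev.
have [cntu cntv] := count_mem_nseq2 u v m n ne_uv.
have [x Sx fx] : exists2 x, x \in S & f x = u.
  by apply: (level_onto lev); rewrite mem_cat mem_nseq m_gt0 eqxx.
have [y Sy fy] : exists2 y, y \in S & f y = v.
  by apply: (level_onto lev); rewrite mem_cat !mem_nseq n_gt0 eqxx orbT.
exists (orbit to A x), (orbit to A y); split.
- apply/setP=> O; rewrite !inE; apply/imsetP/orP => [[z Sz ->]|].
    have := level_mem lev Sz; rewrite mem_cat !mem_nseq m_gt0 n_gt0 /=.
    rewrite !(orbit_level lev) // fx fy.
    by case/orP=> /eqP->; rewrite eqxx; [left | right].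
  by case=> /eqP->; [exists x | exists y].
- apply: contra_neq ne_uv => /setP/(_ x).
  by rewrite !(orbit_level lev) // !inE Sx eqxx /= fx fy => /esym/eqP.
- by rewrite (orbit_level lev) // (card_level _ lev) fx.
- by rewrite (orbit_level lev) // (card_level _ lev) fy.
Qed.

(** A value taken once yields a fixed element; all other levels are orbits with more than one
    element, so nothing else is fixed. *)
Lemma level_fixed {aT : finGroupType} {rT : finType}
    {to : {action aT &-> rT}} {A : {set aT}} {S : {set rT}} {f : rT -> nat}
    {w : nat} {vs : seq nat} :
    w \notin vs -> all (fun v => 1 < count_mem v vs) vs ->
    level_orbits to A S f (w :: vs) ->
  exists x, 'Fix_(S | to)(A)%g = [set x] /\ level_orbits to A (S :\ x) f vs.
Proof.
move=> w_vs /allP vs2 lev; have [x Sx fx] := level_onto lev (mem_head w vs).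
have def_x : [set y in S | f y == w] = [set x].
  apply/esym/eqP; rewrite eqEcard sub1set inE Sx fx eqxx (card_level _ lev).
  by rewrite /= eqxx (count_memPn w_vs) cards1.
have fixx y : y \in S -> (f y == w) = (y == x).
  by move=> Sy; have /setP/(_ y) := def_x; rewrite !inE Sy.
case: (lev) => [perm_vs inv tr].
exists x; split.
  apply/setP=> y; rewrite in_setI in_set1; apply/andP/eqP => [[Sy]|->].
    move/afixP=> fixy; apply/eqP; rewrite -fixx //.
    apply: contraT => ne_fw.
    have := level_mem lev Sy; rewrite inE (negPf ne_fw) /= => /vs2.
    have : orbit to A y \subset [set y].
      by apply/subsetP=> _ /imsetP[a Aa ->]; rewrite fixy // set11.
    move/subset_leq_card; rewrite cards1 (orbit_level lev) // (card_level _ lev).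
    by rewrite /= eq_sym (negPf ne_fw) add0n ltnNge => ->.
  split=> //; apply/afixP=> a Aa; have [Sxa fxa] := inv a x Aa Sx.
  by apply/eqP; rewrite -fixx // fxa fx.
split.
- rewrite -(perm_cons w) perm_sym.
  apply: perm_trans (_ : perm_eq _ [seq f y | y in S]) _.
    by rewrite perm_sym.
  rewrite -fx -map_cons; apply: perm_map; apply: uniq_perm.
  - exact: enum_uniq.
  - by rewrite /= mem_enum !inE eqxx enum_uniq.
  by move=> y; rewrite in_cons !mem_enum in_setD1; case: eqP => // ->.
- move=> a y Aa; rewrite !in_setD1 => /andP[ne_yx Sy].
  have [Sya fya] := inv a y Aa Sy; split=> //.
  by rewrite Sya andbT -fixx // fya fixx.
- by move=> y z; rewrite !in_setD1 => /andP[_ Sy] /andP[_ Sz]; apply: tr.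
Qed.

Lemma level_fixed_and_two_orbits {aT : finGroupType} {rT : finType}
    {to : {action aT &-> rT}} {A : {set aT}} {S : {set rT}} {f : rT -> nat}
    {w u v m n : nat} :
    uniq [:: w; u; v] -> 1 < m -> 1 < n ->
    level_orbits to A S f (w :: nseq m u ++ nseq n v) ->
  fixed_and_two_orbits to A S m n.
Proof.
rewrite /= !inE negb_or andbT => /andP[/andP[ne_wu ne_wv] ne_uv] m_gt1 n_gt1 lev.
have [||x [fixx levx]] := level_fixed _ _ lev.
- by rewrite mem_cat !mem_nseq (negPf ne_wu) (negPf ne_wv) !andbF.
- have [cntu cntv] := count_mem_nseq2 u v m n ne_uv.
  by rewrite all_cat !all_nseq cntu cntv m_gt1 n_gt1 !orbT.
by exists x; split=> //; apply: level_two_orbits levx => //; apply: ltnW.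
Qed.

Lemma level_fixed_and_transitive {aT : finGroupType} {rT : finType}
    {to : {action aT &-> rT}} {A : {set aT}} {S : {set rT}} {f : rT -> nat}
    {w v n : nat} :
    w != v -> 1 < n -> level_orbits to A S f (w :: nseq n v) ->
  fixed_and_transitive to A S.
Proof.
move=> ne_wv n_gt1 lev; have [||x [fixx levx]] := level_fixed _ _ lev.
- by rewrite mem_nseq (negPf ne_wv) andbF.
- by rewrite all_nseq count_nseq /= eqxx mul1n n_gt1 orbT.
exists x; split=> //.
have [y Sy fy] : exists2 y, y \in S :\ x & f y = v.
  by apply: (level_onto levx); rewrite mem_nseq ltnW //= eqxx.
apply/imsetP; exists y => //; rewrite (orbit_level levx) //.
apply/setP=> z; rewrite [RHS]inE fy; case: (boolP (z \in S :\ x)) => // Sz /=.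
by have := level_mem levx Sz; rewrite mem_nseq => /andP[_ ->].
Qed.

Definition spread (gs : seq (seq nat)) (l : seq nat) : seq nat :=
  undup (l ++ [seq nth 0 g i | g <- gs, i <- l]).

(* Five rounds suffice for all the generating sets used below.               *)
Definition transitive_levels (gs : seq (seq nat)) (vs : seq nat) : bool :=
  all (fun v => let l := [seq i <- iota 0 (size vs) | nth 0 vs i == v] in
       if l is h :: _ then all [in iter 5 (spread gs) [:: h]] l else true)
      (undup vs).

Lemma spread_ind (P : nat -> Prop) gs k l :
    (forall g i, g \in gs -> P i -> P (nth 0 g i)) ->
    (forall i, i \in l -> P i) ->
  forall i, i \in iter k (spread gs) l -> P i.
Proof.
move=> Pgs Pl; elim: k => //= k IHk i; rewrite mem_undup mem_cat.
by case/orP=> [/IHk // | /allpairsP[[g j] [gs_g /IHk Pj ->]]]; apply: Pgs.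
Qed.

(** Transfers a computation on indices to orbits: [e] enumerates [S], and each list in [gs] is the
    effect of some element of [A] on the indices. *)
Lemma transitive_level_orbits {aT : finGroupType} {rT : finType}
    {to : {action aT &-> rT}} {A : {group aT}} {S : {set rT}} {f : rT -> nat}
    (vs : seq nat) (e : nat -> rT) (gs : seq (seq nat)) :
    (forall x, reflect (exists2 i, i < size vs & x = e i) (x \in S)) ->
    {in gtn (size vs) &, injective e} ->
    (forall i, i < size vs -> f (e i) = nth 0 vs i) ->
    (forall a x, a \in A -> x \in S -> to x a \in S /\ f (to x a) = f x) ->
    (forall g, g \in gs -> exists2 a, a \in A & forall i, i < size vs ->
       nth 0 g i < size vs /\ to (e i) a = e (nth 0 g i)) ->
    transitive_levels gs vs ->
  level_orbits to A S f vs.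
Proof.
move=> defS inj_e fE inv gsA /allP tr; split=> //.
  have /(perm_map f)/perm_trans -> // :
      perm_eq (enum S) [seq e i | i <- iota 0 (size vs)].
    apply: uniq_perm; first exact: enum_uniq.
      rewrite map_inj_in_uniq ?iota_uniq // => i j.
      by rewrite !mem_iota !add0n; apply: inj_e.
    move=> x; rewrite mem_enum; apply/defS/mapP => -[i lti ->]; exists i => //.
      by rewrite mem_iota.
    by move: lti; rewrite mem_iota.
  have /eq_in_map eq_fe : {in iota 0 (size vs), f \o e =1 nth 0 vs}.
    by move=> i; rewrite mem_iota add0n => /andP[_ /fE].
  by rewrite -map_comp eq_fe map_nth_iota0 ?take_size.
move=> _ _ /defS[i lti ->] /defS[j ltj ->]; rewrite !fE // => eq_v.
have vs_i : nth 0 vs i \in undup vs by rewrite mem_undup mem_nth.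
have := tr _ vs_i; set l := [seq k <- _ | _] => lr.
have [li lj] : i \in l /\ j \in l.
  by rewrite !mem_filter !mem_iota lti ltj -eq_v eqxx.
case def_l: l li lj lr => [//|h l'] li lj /allP lr.
have lth : h < size vs.
  have : h \in l by rewrite def_l mem_head.
  by rewrite mem_filter mem_iota => /andP[].
have hP k : k \in h :: l' -> e k \in orbit to A (e h).
  move/lr; pose P k := k < size vs /\ e k \in orbit to A (e h).
  suff Pr n : k \in iter n (spread gs) [:: h] -> P k
    by move=> r_k; have [] := Pr 5 r_k.
  apply: (spread_ind P) => [g m gs_g [ltm orb_m] | m]; last first.
    by rewrite inE => /eqP->; split=> //; apply: orbit_refl.
  have [a Aa /(_ m ltm)[ltg toE]] := gsA g gs_g; split=> //; rewrite -toE.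
  exact: orbit_trans (mem_orbit to _ Aa) orb_m.
(* The search only runs forward from the first index [h] of the level; symmetry of orbits connects
   any two members through it. *)
apply: orbit_trans (hP _ lj) _; rewrite orbit_sym; exact: hP.
Qed.

(** * Invariants of blocks and points under automorphisms *)

Lemma setactPE (X : {set 'I_15}) (a : {perm 'I_15}) : 'P^*%act X a = a @: X.
Proof. exact: eq_imset. Qed.

Lemma mem_symdiff_aut (B : {set {set 'I_15}}) a X Y : a \in design_aut B ->
  (symdiff ('P^*%act X a) ('P^*%act Y a) \in B) = (symdiff X Y \in B).
Proof. by move=> Ba; rewrite !setactPE -imset_symdiff -setactPE (astabs_act _ Ba). Qed.

(** For a block [X] of a design this is twice the number of lines of [P4] inside [B] through [X],
    since [Y] and [symdiff X Y] complete the same line. *)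
Definition sum_count (B : {set {set 'I_15}}) (X : {set 'I_15}) : nat :=
  #|[set Y in B | symdiff X Y \in B]|.

Definition point_weight (B : {set {set 'I_15}}) (p : 'I_15) : nat :=
  \sum_(X in B | p \in X) sum_count B X.

Lemma sum_count_aut B a X : a \in design_aut B ->
  sum_count B ('P^*%act X a) = sum_count B X.
Proof.
move=> Ba; rewrite /sum_count -[LHS](card_preimset _ (act_inj ('P^*)%act a)).
congr #|pred_of_set _|; apply/setP=> Y.
by rewrite !inE (astabs_act Y Ba) mem_symdiff_aut.
Qed.

Lemma point_weight_aut B (a : {perm 'I_15}) p : a \in design_aut B ->
  point_weight B (a p) = point_weight B p.
Proof.
move=> Ba; rewrite /point_weight (reindex_inj (act_inj ('P^*)%act a)) /=.
apply: eq_big => [X|X _]; last exact: (sum_count_aut B a X Ba).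
by rewrite (astabs_act X Ba) setactPE mem_imset //; apply: perm_inj.
Qed.

Definition sum_counts (D : seq bitseq) : seq nat :=
  [seq count (fun c => xor b c \in D) D | b <- D].

Definition point_weights (D : seq bitseq) : seq nat :=
  let t := [seq (b, count (fun c => xor b c \in D) D) | b <- D] in
  [seq sumn [seq x.2 | x <- t & nth false x.1 i] | i <- iota 0 15].

(* A permutation of the labels is given by the list of its values.            *)
Definition permute (g : seq nat) (b : bitseq) : bitseq :=
  [seq nth false b (index i g) | i <- iota 0 15].

(** A single pool serves all designs; each design selects the members that preserve it. *)
Definition preservers (gs : seq (seq nat)) (D : seq bitseq) : seq (seq nat) :=
  [seq g <- gs | all (fun b => permute g b \in D) D].

Definition block_perm (D : seq bitseq) (g : seq nat) : seq nat :=
  [seq index (permute g b) D | b <- D].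

Lemma perm_of_list (g : seq nat) : perm_eq g (iota 0 15) ->
  exists a : {perm 'I_15}, forall i : 'I_15, nat_of_ord (a i) = nth 0 g i.
Proof.
move=> pg; have sz_g : size g = 15 by rewrite (perm_size pg) size_iota.
have ltg (i : 'I_15) : nth 0 g i < 15.
  have : nth 0 g i \in g by rewrite mem_nth ?sz_g.
  by rewrite (perm_mem pg) mem_iota.
have injg : injective (fun i => Ordinal (ltg i)).
  move=> i j /(congr1 val) /= /eqP.
  rewrite nth_uniq ?sz_g ?(perm_uniq pg) ?iota_uniq //.
  by move/eqP/val_inj.
by exists (perm injg) => i; rewrite permE.
Qed.

(** Products of permutations apply the left factor first, so [s * a * s^-1] passes to labels,
    permutes them and returns to points. The image of a block is read through the inverse of [g],
    hence the [index] in [permute]. *)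
Lemma blk_permute s (a : {perm 'I_15}) (g : seq nat) b :
    perm_eq g (iota 0 15) -> (forall i : 'I_15, nat_of_ord (a i) = nth 0 g i) ->
  'P^*%act (blk s b) (s * a * s^-1)%g = blk s (permute g b).
Proof.
move=> pg aE; have sz_g : size g = 15 by rewrite (perm_size pg) size_iota.
have ug : uniq g by rewrite (perm_uniq pg) iota_uniq.
apply/setP=> p; rewrite setactPE -[p](permKV (s * a * s^-1)%g).
rewrite mem_imset; last exact: perm_inj.
set q := (_ p); rewrite !inE !permM permKV.
rewrite (nth_map 0) ?size_iota // nth_iota // aE index_uniq ?sz_g //.
Qed.

Lemma sum_count_blocks s D b : all (fun c => size c == 15) D -> uniq D ->
    size b = 15 ->
  sum_count (blocks s D) (blk s b) = count (fun c => xor b c \in D) D.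
Proof.
move=> sz_D uD sz_b; rewrite -size_filter -(card_blocks s); first last.
- exact: filter_uniq.
- by apply/allP=> c; rewrite mem_filter => /andP[_ /(allP sz_D)].
congr #|pred_of_set _|; apply/setP=> X; have [c sz_c ->] := blk_onto s X.
rewrite inE symdiff_blk // !mem_blocks //; first by rewrite mem_filter andbC.
- by apply/allP=> d; rewrite mem_filter => /andP[_ /(allP sz_D)].
- by rewrite size_xor sz_b.
Qed.

Lemma point_weight_blocks s D p : all (fun c => size c == 15) D -> uniq D ->
  point_weight (blocks s D) p = nth 0 (point_weights D) (s p).
Proof.
move=> sz_D uD; rewrite (nth_map 0) ?size_iota // nth_iota // add0n.
rewrite sumnE big_map big_filter big_map big_mkcond /=.
rewrite /point_weight big_mkcondr /= (eq_bigl [in [seq blk s b | b <- D]]); last first.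
  by move=> X; rewrite inE.
rewrite -big_uniq; last first.
  rewrite map_inj_in_uniq // => b c /(allP sz_D)/eqP sz_b /(allP sz_D)/eqP sz_c.
  exact: blk_inj.
rewrite big_map; apply: eq_big_seq => b /(allP sz_D)/eqP sz_b.
by rewrite inE sum_count_blocks.
Qed.

Definition orbits_certified (gs : seq (seq nat)) (D : seq bitseq) : bool :=
  let hs := preservers gs D in
  transitive_levels hs (point_weights D) &&
  transitive_levels [seq block_perm D g | g <- hs] (sum_counts D).

Lemma design_level_orbits s (D : seq bitseq) (gs : seq (seq nat)) :
    all (fun c => size c == 15) D -> uniq D ->
    all (fun g => perm_eq g (iota 0 15)) gs -> orbits_certified gs D ->
  let B := blocks s D in
  level_orbits 'P%act (design_aut B) setT (point_weight B) (point_weights D) /\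
  level_orbits 'P^*%act (design_aut B) B (sum_count B) (sum_counts D).
Proof.
move=> sz_D uD /allP perm_gs /andP[ptD blD] B.
have autP g : g \in preservers gs D -> perm_eq g (iota 0 15) /\
    exists2 a : {perm 'I_15}, (s * a * s^-1)%g \in design_aut B
      & forall i : 'I_15, nat_of_ord (a i) = nth 0 g i.
  rewrite mem_filter => /andP[/allP D_g /perm_gs pg]; split=> //.
  have [a aE] := perm_of_list g pg; exists a => //.
  (* To lie in the setwise stabiliser it is enough to map [B] into itself. *)
  rewrite !inE; apply/subsetP=> X; rewrite inE => /mapP[b Db ->].
  by rewrite inE (blk_permute s a g b pg aE) /B inE map_f // D_g.
split.
  have sz_w : size (point_weights D) = 15 by rewrite size_map size_iota.
  apply: (transitive_level_orbits _ (fun i => (s^-1)%g (inord i)) (preservers gs D)).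
  - rewrite sz_w => p; rewrite in_setT; apply: ReflectT.
    by exists (s p) => //; rewrite inord_val permK.
  - move=> i j; rewrite sz_w => lti ltj /perm_inj/(congr1 (@nat_of_ord _)).
    by rewrite !inordK.
  - by move=> i; rewrite sz_w => lti; rewrite point_weight_blocks // permKV inordK.
  - by move=> a p Ba _; rewrite point_weight_aut ?in_setT.
  - move=> g /autP[pg [a Ba aE]]; exists (s * a * s^-1)%g => // i.
    rewrite sz_w => lti; rewrite /= /aperm !permM permKV.
    have := aE (inord i); rewrite inordK // => <-.
    by rewrite ltn_ord inord_val.
  - exact: ptD.
have sz_c : size (sum_counts D) = size D by rewrite size_map.
apply: (transitive_level_orbits _ (fun i => blk s (nth [::] D i))
          [seq block_perm D g | g <- preservers gs D]).
- rewrite sz_c => X; rewrite inE; apply: (iffP mapP) => [[b Db ->]|[i lti ->]].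
    by exists (index b D); rewrite ?index_mem ?nth_index.
  by exists (nth [::] D i); rewrite ?mem_nth.
- move=> i j; rewrite sz_c => lti ltj /blk_inj eq_ij; apply/eqP.
  rewrite -(nth_uniq [::] lti ltj uD) eq_ij //; apply/eqP/(allP sz_D)/mem_nth => //.
- move=> i; rewrite sz_c => lti; have Di : nth [::] D i \in D by rewrite mem_nth.
  by rewrite sum_count_blocks ?(eqP (allP sz_D _ Di)) // (nth_map [::]).
- by move=> a X Ba BX; rewrite (astabs_act X Ba) sum_count_aut.
- move=> _ /mapP[g pres_g ->]; have [pg [a Ba aE]] := autP g pres_g.
  exists (s * a * s^-1)%g => // i; rewrite sz_c => lti.
  have Di : nth [::] D i \in D by rewrite mem_nth.
  move: pres_g; rewrite mem_filter => /andP[/allP/(_ _ Di) Dgi _].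
  rewrite (nth_map [::]) // index_mem Dgi nth_index //; split=> //.
  exact: blk_permute.
- exact: blD.
Qed.

(* Found by a computer search among the automorphisms of the designs          *)
(* enumerated below.                                                          *)
Definition automorphism_pool : seq (seq nat) := [::
  [:: 0; 1; 2; 3; 4; 5; 6; 8; 7; 10; 9; 12; 11; 14; 13];
  [:: 0; 1; 2; 3; 4; 5; 6; 9; 10; 7; 8; 13; 14; 11; 12];
  [:: 0; 1; 2; 3; 4; 5; 6; 11; 12; 13; 14; 7; 8; 9; 10];
  [:: 0; 3; 4; 5; 6; 1; 2; 7; 12; 11; 8; 13; 10; 9; 14];
  [:: 1; 2; 0; 3; 5; 6; 4; 7; 9; 10; 8; 13; 11; 12; 14];
  [:: 3; 1; 5; 4; 0; 6; 2; 7; 11; 13; 9; 12; 8; 10; 14];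
  [:: 0; 4; 3; 2; 1; 5; 6; 7; 8; 12; 11; 10; 9; 13; 14];
  [:: 0; 3; 4; 5; 6; 1; 2; 7; 8; 11; 12; 13; 14; 9; 10];
  [:: 1; 2; 0; 3; 5; 6; 4; 7; 9; 10; 8; 11; 13; 14; 12];
  [:: 3; 1; 5; 4; 0; 6; 2; 7; 11; 9; 13; 12; 8; 14; 10];
  [:: 1; 2; 0; 5; 3; 4; 6; 7; 9; 10; 8; 13; 11; 12; 14];
  [:: 1; 2; 0; 5; 3; 4; 6; 7; 9; 10; 8; 11; 13; 14; 12];
  [:: 2; 5; 4; 1; 0; 3; 6; 7; 8; 13; 14; 9; 10; 11; 12];
  [:: 3; 5; 1; 4; 0; 2; 6; 7; 11; 9; 13; 12; 8; 14; 10];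
  [:: 0; 1; 2; 6; 5; 4; 3; 7; 9; 8; 10; 14; 12; 13; 11];
  [:: 0; 6; 5; 3; 4; 2; 1; 7; 11; 14; 10; 8; 12; 13; 9];
  [:: 1; 2; 0; 4; 6; 5; 3; 7; 10; 8; 9; 14; 11; 13; 12];
  [:: 5; 7; 13; 14; 8; 6; 0; 1; 3; 11; 9; 10; 12; 4; 2];
  [:: 1; 2; 0; 6; 4; 3; 5; 7; 10; 8; 9; 13; 12; 14; 11];
  [:: 3; 6; 2; 4; 0; 1; 5; 7; 12; 13; 10; 8; 11; 14; 9];
  [:: 2; 1; 0; 3; 6; 5; 4; 7; 8; 9; 10; 13; 14; 11; 12];
  [:: 4; 1; 6; 3; 0; 5; 2; 7; 8; 13; 14; 11; 12; 9; 10];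
  [:: 0; 1; 2; 4; 3; 6; 5; 7; 8; 10; 9; 11; 12; 14; 13];
  [:: 0; 1; 2; 4; 3; 6; 5; 7; 8; 10; 9; 12; 11; 13; 14];
  [:: 0; 1; 2; 5; 6; 3; 4; 7; 10; 9; 8; 11; 14; 13; 12];
  [:: 0; 1; 2; 7; 8; 9; 10; 3; 4; 5; 6; 11; 12; 13; 14];
  [:: 0; 3; 4; 1; 2; 5; 6; 7; 8; 11; 12; 9; 10; 13; 14];
  [:: 0; 5; 6; 3; 4; 1; 2; 7; 12; 9; 14; 11; 8; 13; 10];
  [:: 0; 7; 8; 3; 4; 11; 12; 1; 2; 9; 10; 5; 6; 13; 14];
  [:: 7; 1; 9; 3; 11; 5; 13; 0; 8; 2; 10; 4; 12; 6; 14];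
  [:: 7; 1; 9; 12; 4; 14; 6; 0; 8; 2; 10; 11; 3; 13; 5];
  [:: 7; 10; 2; 3; 11; 14; 6; 0; 8; 9; 1; 4; 12; 13; 5];
  [:: 0; 1; 2; 11; 12; 13; 14; 7; 8; 9; 10; 3; 4; 5; 6];
  [:: 0; 9; 10; 3; 4; 13; 14; 7; 8; 1; 2; 11; 12; 5; 6];
  [:: 1; 2; 0; 4; 6; 5; 3; 7; 9; 10; 8; 12; 14; 13; 11];
  [:: 1; 2; 0; 6; 4; 3; 5; 7; 9; 10; 8; 14; 12; 11; 13];
  [:: 0; 3; 4; 6; 5; 2; 1; 7; 8; 11; 12; 14; 13; 10; 9];
  [:: 0; 4; 3; 5; 6; 2; 1; 7; 8; 12; 11; 13; 14; 10; 9];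
  [:: 0; 4; 3; 6; 5; 1; 2; 7; 8; 12; 11; 14; 13; 9; 10]].

(** * Frames, expected invariants and the verified enumeration *)

Definition centred_frame : seq bitseq :=
  [:: digit 3; digit 0; digit 1; digit 2; xor (digit 3) (digit 0);
      xor (digit 3) (digit 1); xor (digit 3) (digit 2)].

(** The nonzero sums of three coordinate functions: the deleted Fano plane of type (NC). Adding
    [digit 3] gives the eight remaining members of the singular subspace. *)
Definition fano_frame : seq bitseq :=
  [:: digit 0; digit 1; xor (digit 0) (digit 1); digit 2;
      xor (digit 0) (digit 2); xor (digit 1) (digit 2);
      xor (xor (digit 0) (digit 1)) (digit 2)].

Definition affine_frame : seq bitseq :=
  digit 3 :: [seq xor (digit 3) b | b <- fano_frame].

Definition profile (D : seq bitseq) (vs ws : seq nat) : bool :=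
  [&& perm_eq (sum_counts D) vs, perm_eq (point_weights D) ws,
      all (fun b => size b == 15) D, uniq D
    & orbits_certified automorphism_pool D].

(** The block values are twice the number of lines through a block: seven lines at a centre, three
    at any other block of a Fano plane of the design, one at a block joined only to the centre, none
    at a block of (NC) off its Fano plane. The point weights are read off the enumerated designs. *)
Definition counts_C2 : seq nat := nseq 3 14 ++ nseq 12 6.
Definition weights_C2 : seq nat := nseq 3 48 ++ nseq 12 64.
Definition counts_C3 : seq nat := 14 :: nseq 6 6 ++ nseq 8 2.
Definition weights_C3 : seq nat := 16 :: nseq 6 32 ++ nseq 8 40.
Definition counts_C4 : seq nat := 14 :: nseq 14 2.
Definition weights_C4 : seq nat := nseq 7 16 ++ nseq 8 28.
Definition counts_NC : seq nat := nseq 7 6 ++ nseq 8 0.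
Definition weights_NC : seq nat := 0 :: nseq 14 24.

(** Every block is a centre, so the blocks are closed under sums of distinct members. *)
Definition linear_design (D : seq bitseq) : bool :=
  [&& all (pred1 14) (sum_counts D), all (fun b => size b == 15) D & uniq D].

Definition orbit_profile (B : {set {set 'I_15}}) (vs ws : seq nat) : Prop :=
  level_orbits 'P%act (design_aut B) setT (point_weight B) ws /\
  level_orbits 'P^*%act (design_aut B) B (sum_count B) vs.

Lemma profile_orbit_profile s (D : seq bitseq) (vs ws : seq nat) :
  profile D vs ws -> orbit_profile (blocks s D) vs ws.
Proof.
case/and5P=> perm_vs perm_ws sz_D uD cert.
have valid : all (fun g => perm_eq g (iota 0 15)) automorphism_pool by vm_compute.
have [[pt1 pt2 pt3] [bl1 bl2 bl3]] :=
  design_level_orbits s D automorphism_pool sz_D uD valid cert.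
split; first by split; [exact: perm_trans pt1 perm_ws | exact: pt2 | exact: pt3].
by split; [exact: perm_trans bl1 perm_vs | exact: bl2 | exact: bl3].
Qed.

Lemma linear_design_sum_count s (D : seq bitseq) X :
  linear_design D -> X \in blocks s D -> sum_count (blocks s D) X = 14.
Proof.
case/and3P=> /allP D14 sz_D uD; rewrite inE => /mapP[b Db ->].
rewrite sum_count_blocks ?(eqP (allP sz_D _ Db)) //.
by apply/eqP/D14/mapP; exists b.
Qed.

Lemma centred_completions :
  all (fun D => [|| linear_design D, profile D counts_C2 weights_C2,
                    profile D counts_C3 weights_C3
                  | profile D counts_C4 weights_C4])
    (completions centred_frame).
Proof. by vm_compute. Qed.

(** Completions meeting the deleted plane are let through unchecked, because a design of type (NC)
    contains no block of that plane. *)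
Lemma affine_completions :
  all (fun D => has [in D] fano_frame || profile D counts_NC weights_NC)
    (completions affine_frame).
Proof. by vm_compute. Qed.

(** * Designs of the four types *)

Definition star (B : {set {set 'I_15}}) (p : 'I_15) : {set {set 'I_15}} :=
  [set X in B | p \in X].

Lemma card_starI B p q :
  #|star B p :&: star B q| = \sum_(X in B) (p \in X) * (q \in X).
Proof.
rewrite -sum1_card big_mkcond [RHS]big_mkcond; apply: eq_bigr => X _.
by rewrite !inE; case: (X \in B); case: (p \in X); case: (q \in X).
Qed.

Lemma card_setI_sum {T : finType} (X Y : {set T}) :
  #|X :&: Y| = \sum_x (x \in X) * (x \in Y).
Proof.
rewrite -sum1_card big_mkcond; apply: eq_bigr => x _.
by rewrite inE; case: (x \in X); case: (x \in Y).
Qed.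

(* With c = 4 + 4 [p = q], the sums of |star p :&: star q| ^ 2, of            *)
(* |star p :&: star q| * c and of c ^ 2 over all p, q coincide, which is the  *)
(* equality case of the Cauchy-Schwarz inequality.                            *)
Lemma design_star B p q : design_15_8_4 B ->
  #|star B p :&: star B q| = 4 + 4 * (p == q).
Proof.
case=> cardB card8 card4.
pose c (x : 'I_15 * 'I_15) := 4 + 4 * (x.1 == x.2).
pose l (x : 'I_15 * 'I_15) := #|star B x.1 :&: star B x.2|.
have sumB (F : nat -> nat) X : X \in B ->
    \sum_(Y in B) F #|X :&: Y| = F 8 + 14 * F 4.
  move=> BX; rewrite (bigD1 X) //= setIid card8 //; congr (_ + _).
  rewrite (eq_bigr (fun=> F 4)) => [|Y /andP[BY ne]]; last first.
    by rewrite card4 // eq_sym.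
  rewrite sum_nat_const; congr (_ * _).
  transitivity #|B :\ X|; first by apply: eq_card => Y; rewrite in_setD1 andbC.
  by have := cardsD1 X B; rewrite BX cardB; lia.
(* For the incidence matrix N this is the trace identity for the squares of N^T N and N N^T; each of
   the 15 blocks contributes 8^2 + 14 * 4^2 = 288. *)
have sum_ll : \sum_x l x ^ 2 = 4320.
  transitivity (\sum_(X in B) \sum_(Y in B) #|X :&: Y| ^ 2); last first.
    rewrite (eq_bigr (fun=> 288)) ?sum_nat_const ?cardB // => X BX.
    exact: (sumB (fun k => k ^ 2)).
  rewrite -(pair_big predT predT (fun x y => l (x, y) ^ 2)) /=.
  under [RHS]eq_bigr => X _ do under eq_bigr => Y _ do
    rewrite card_setI_sum -mulnn big_distrlr /=.
  rewrite [RHS](eq_bigr (fun X : {set 'I_15} => \sum_x \sum_(Y in B) \sum_y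
     (x \in X) * (x \in Y) * ((y \in X) * (y \in Y)))); last first.
    by move=> X _; rewrite exchange_big.
  rewrite [RHS]exchange_big; apply: eq_bigr => x _.
  rewrite [RHS](eq_bigr (fun X : {set 'I_15} => \sum_y \sum_(Y in B)
     (x \in X) * (x \in Y) * ((y \in X) * (y \in Y)))); last first.
    by move=> X _; rewrite exchange_big.
  rewrite [RHS]exchange_big; apply: eq_bigr => y _.
  rewrite /l /= card_starI -mulnn big_distrlr; apply: eq_bigr => X _.
  by apply: eq_bigr => Y _; rewrite mulnACA.
have sum_l : \sum_x l x = 960.
  rewrite -(pair_big predT predT (fun x y => l (x, y))) /=.
  transitivity (\sum_(X in B) #|X :&: X| ^ 2); last first.
    rewrite (eq_bigr (fun=> 64)) ?sum_nat_const ?cardB // => X BX.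
    by rewrite setIid card8.
  under [RHS]eq_bigr => X _ do rewrite card_setI_sum -mulnn big_distrlr /=.
  rewrite [RHS]exchange_big; apply: eq_bigr => x _.
  rewrite [RHS]exchange_big; apply: eq_bigr => y _.
  rewrite /l /= card_starI; apply: eq_bigr => X _.
  by case: (x \in X); case: (y \in X).
have sum_ld : \sum_x l x * (x.1 == x.2) = 120.
  rewrite -(pair_big predT predT (fun x y => l (x, y) * (x == y))) /=.
  transitivity (\sum_(X in B) #|X :&: X|); last first.
    rewrite (eq_bigr (fun=> 8)) ?sum_nat_const ?cardB // => X BX.
    by rewrite setIid card8.
  under [RHS]eq_bigr => X _ do rewrite card_setI_sum.
  rewrite [RHS]exchange_big; apply: eq_bigr => x _.
  rewrite (bigD1 x) //= eqxx muln1 big1 ?addn0 => [|y]; last first.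
    by rewrite eq_sym => /negPf->; rewrite muln0.
  by rewrite /l card_starI.
have sum_lc : \sum_x l x * c x = 4320.
  rewrite (eq_bigr (fun x => l x * 4 + l x * (x.1 == x.2) * 4)) => [|x _]; last first.
    by rewrite /c; lia.
  by rewrite big_split -!big_distrl sum_l sum_ld.
have sum_cc : \sum_x c x ^ 2 = 4320.
  rewrite -(pair_big predT predT (fun x y => c (x, y) ^ 2)) /=.
  rewrite (eq_bigr (fun=> 288)) ?sum_nat_const ?card_ord // => x _.
  rewrite (bigD1 x) //= (eq_bigr (fun=> 16)); last first.
    by move=> y; rewrite eq_sym /c /= => /negPf->.
  by rewrite sum_nat_const cardC1 card_ord /c eqxx.
have sum_2lc : \sum_x 2 * (l x * c x) = 8640 by rewrite -big_distrr /= sum_lc.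
(* Termwise 2lc is at most l^2 + c^2, with equality only for l = c; the totals agree, so every term
   is an equality. *)
have := leqif_sum (fun x (_ : true) => nat_Cauchy (l x) (c x)).
rewrite /= sum_2lc big_split /= sum_ll sum_cc => -[_].
by rewrite eqxx => /esym/forallP/(_ (p, q))/eqP.
Qed.

Lemma design_separation B (p q : 'I_15) : design_15_8_4 B -> p != q ->
  #|[set X in B | (p \in X) != (q \in X)]| = 8.
Proof.
move=> hB ne_pq; have := card_symdiff (star B p) (star B q).
have -> : [set X in B | (p \in X) != (q \in X)] = symdiff (star B p) (star B q).
  by apply/setP=> X; rewrite in_symdiff !inE -addbN; case: (X \in B) => //=;
     case: (p \in X); case: (q \in X).
have := design_star B p p hB; have := design_star B q q hB.
by rewrite !setIid (design_star B p q hB) !eqxx (negPf ne_pq); lia.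
Qed.

Lemma design_separation2 B (p q p' q' : 'I_15) : design_15_8_4 B ->
    p != q -> p' != q' ->
  exists2 X, X \in B & ((p \in X) != (q \in X)) && ((p' \in X) != (q' \in X)).
Proof.
move=> hB ne_pq ne_pq'; have [cardB _ _] := hB.
have := design_separation B _ _ hB ne_pq; set S := [set X in B | _] => cardS.
have := design_separation B _ _ hB ne_pq'; set S' := [set X in B | _] => cardS'.
(* Two sets of 8 blocks among 15 must meet. *)
have : 0 < #|S :&: S'|.
  have := cardsUI S S'; rewrite cardS cardS' => cUI.
  have : #|S :|: S'| <= 15.
    apply: leq_trans (_ : #|B| <= 15); last by rewrite cardB.
    rewrite subset_leq_card //; apply/subsetP=> X; rewrite !inE.
    by case/orP=> /andP[].
  lia.
case/card_gt0P=> X; rewrite !inE => /andP[/andP[BX sep] /andP[_ sep']].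
by exists X => //; rewrite sep.
Qed.

Lemma design_P4_points {B : {set {set 'I_15}}} {X : {set 'I_15}} :
  design_15_8_4 B -> X \in B -> X \in P4_points.
Proof. by case=> _ card8 _ /card8 cX; rewrite inE cX. Qed.

Lemma design_symdiff_neq {B : {set {set 'I_15}}} {X Y : {set 'I_15}} :
  design_15_8_4 B -> symdiff X Y \in B -> X != Y.
Proof.
move=> [_ card8 _]; apply: contraTneq => ->; rewrite symdiffv.
by apply/negP=> /card8; rewrite cards0.
Qed.

Lemma design_line {B : {set {set 'I_15}}} {X Y : {set 'I_15}} :
    design_15_8_4 B -> X \in B -> Y \in B -> symdiff X Y \in B ->
  [set X; Y; symdiff X Y] \in lines P4 /\ [set X; Y; symdiff X Y] \subset B.
Proof.
move=> hB BX BY BXY; split; first by apply: P4_line; apply: (design_P4_points hB).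
by rewrite !subUset !sub1set BX BY.
Qed.

Lemma card_setD1 {T : finType} (A : {set T}) x n :
  x \in A -> #|A| = n.+1 -> #|A :\ x| = n.
Proof. by move=> Ax; rewrite (cardsD1 x) Ax => -[]. Qed.

Lemma leq_card_set3 {T : finType} (x y z : T) : #|[set x; y; z]| <= 3.
Proof. by rewrite cardsU cards2 cards1; case: (x != y); lia. Qed.

Lemma card_set2I {T : finType} (A : {set T}) x y :
  (x \in A) != (y \in A) -> #|[set x; y] :&: A| = 1.
Proof.
wlog Ax : x y / x \in A => [IH | ].
  case Ax: (x \in A) => [/=|] ne_A; first by apply: IH; rewrite Ax.
  rewrite setUC; apply: IH; last by rewrite Ax eq_sym.
  by case: (y \in A) ne_A.
rewrite Ax => /= nAy; apply/eqP/cards1P; exists x; apply/setP=> z.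
rewrite !inE; case: (z =P x) => [-> // | _] /=; case: (z =P y) => //= ->.
by case: (y \in A) nAy.
Qed.

Lemma sum_count_eq14 {B : {set {set 'I_15}}} {X : {set 'I_15}} :
    design_15_8_4 B -> X \in B ->
  sum_count B X = 14 <-> (forall Y, Y \in B -> Y != X -> symdiff X Y \in B).
Proof.
move=> hB BX; have [cardB _ _] := hB.
have cardBX : #|B :\ X| = 14 by apply: card_setD1.
have subBX : [set Y in B | symdiff X Y \in B] \subset B :\ X.
  apply/subsetP=> Y; rewrite !inE => /andP[BY BXY].
  by rewrite BY eq_sym (design_symdiff_neq hB BXY).
split=> [cX Y BY ne_YX | hX].
  have : Y \in B :\ X by rewrite in_setD1 ne_YX.
  have /eqP <- : [set Y in B | symdiff X Y \in B] == B :\ X.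
    by rewrite eqEcard subBX cardBX; apply/eq_leq/esym.
  by rewrite inE => /andP[].
rewrite -cardBX; congr #|pred_of_set _|; apply/eqP; rewrite eqEsubset subBX /=.
by apply/subsetP=> Y; rewrite !inE => /andP[ne_YX BY]; rewrite BY hX.
Qed.

(** The only line of the design that can pass through [Y] is the one joining it to [X]. *)
Lemma sum_count_le2 {B : {set {set 'I_15}}} {X Y : {set 'I_15}} :
    design_15_8_4 B -> Y \in B -> Y != X ->
    (forall L, L \in lines P4 -> L \subset B -> Y \in L -> X \in L) ->
  sum_count B Y <= 2.
Proof.
move=> hB BY ne_YX lineY.
apply: leq_trans (_ : #|[set X; symdiff Y X]| <= 2); last by rewrite cards2; case: eqP.
apply: subset_leq_card; apply/subsetP=> Z; rewrite !inE => /andP[BZ BYZ].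
have [hL LB] := design_line hB BY BZ BYZ.
have := lineY _ hL LB; rewrite !inE eqxx => /(_ isT).
rewrite eq_sym (negPf ne_YX) /= => /orP[/eqP->|]; first by rewrite eqxx.
by rewrite eq_sym symdiff_eq => ->; rewrite orbT.
Qed.

(** Triples containing the centre [X] meet in 2 points automatically, since sums with [X] are
    blocks. For [Y1], [Y2], [Y3] no such closure is available, so [Y3] is chosen to split both
    2-point parts of [Y1 :&: Y2], inside and outside [X]. *)
Lemma centred_labelling {B : {set {set 'I_15}}} {X : {set 'I_15}} :
    design_15_8_4 B -> X \in B -> sum_count B X = 14 ->
  exists s, all (fun b => blk s b \in B) centred_frame.
Proof.
move=> hB BX /(sum_count_eq14 hB BX) hX; have [cardB card8 card4] := hB.
have triple Y Z : Y \in B -> Z \in B -> Y != X -> Z != X -> Z != Y ->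
    Z != symdiff X Y -> #|X :&: Y :&: Z| = 2.
  move=> BY BZ nYX nZX nZY nZXY; apply: (card_setI_half 4).
  - by rewrite card4 // eq_sym.
  - by rewrite card4 // eq_sym.
  - by rewrite card4 // hX.
have avoid (A : {set {set 'I_15}}) : #|A| < 15 -> exists2 Y, Y \in B & Y \notin A.
  move=> ltA; apply/subsetPn; apply: contraL ltA => /subset_leq_card.
  by rewrite cardB -leqNgt.
have [Y1 BY1] : exists2 Y, Y \in B & Y \notin [set X].
  by apply: avoid; rewrite cards1.
rewrite inE => nY1X; have BXY1 := hX _ BY1 nY1X.
have [Y2 BY2] : exists2 Y, Y \in B & Y \notin [set X; Y1; symdiff X Y1].
  by apply: avoid; apply: leq_ltn_trans (leq_card_set3 _ _ _) _.
rewrite !inE !negb_or => /andP[/andP[nY2X nY2Y1] nY2XY1].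
have cX12 := triple _ _ BY1 BY2 nY1X nY2X nY2Y1 nY2XY1.
have c12 : #|Y1 :&: Y2| = 4 by rewrite card4 // eq_sym.
have [p [q [ne_pq def_pq]]] : exists p q, p != q /\ X :&: Y1 :&: Y2 = [set p; q].
  by have /eqP/cards2P[p [q [? ?]]] := cX12; exists p, q.
have cD : #|Y1 :&: Y2 :\: X| = 2.
  by rewrite cardsD c12 setIC setIA cX12.
have [p' [q' [ne_pq' def_pq']]] : exists p q, p != q /\ Y1 :&: Y2 :\: X = [set p; q].
  by have /eqP/cards2P[p' [q' [? ?]]] := cD; exists p', q'.
have [Y3 BY3 /andP[sep sep']] := design_separation2 B p q p' q' hB ne_pq ne_pq'.
have inX z : z \in [set p; q] -> [&& z \in X, z \in Y1 & z \in Y2].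
  by rewrite -def_pq !inE -andbA.
have /and3P[pX p1 p2] := inX p (set21 p q).
have /and3P[qX q1 q2] := inX q (set22 p q).
(* Both [p] and [q] lie in [X], [Y1] and [Y2], so none of these blocks, nor a sum of two of them,
   separates the pair as [Y3] does. *)
have sep_neq (Z : {set 'I_15}) : (p \in Z) = (q \in Z) -> Y3 != Z.
  by move=> eqZ; apply: contraNneq sep => ->; rewrite eqZ.
have nY3X : Y3 != X by apply: sep_neq; rewrite pX qX.
have nY31 : Y3 != Y1 by apply: sep_neq; rewrite p1 q1.
have nY32 : Y3 != Y2 by apply: sep_neq; rewrite p2 q2.
have nY3X1 : Y3 != symdiff X Y1 by apply: sep_neq; rewrite !in_symdiff pX qX p1 q1.
have nY3X2 : Y3 != symdiff X Y2 by apply: sep_neq; rewrite !in_symdiff pX qX p2 q2.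
have c3 : #|X :&: Y1 :&: Y2 :&: Y3| = 1 by rewrite def_pq card_set2I.
have c123 : #|Y1 :&: Y2 :&: Y3| = 2.
  rewrite -(cardsID X) setIC !setIA c3.
  have -> : (Y1 :&: Y2 :&: Y3) :\: X = [set p'; q'] :&: Y3.
    by rewrite -def_pq' setIDAC.
  by rewrite card_set2I.
have cX13 := triple _ _ BY1 BY3 nY1X nY3X nY31 nY3X1.
have cX23 := triple _ _ BY2 BY3 nY2X nY3X nY32 nY3X2.
(* The centre comes last so that it becomes [digit 3], as in [centred_frame]. *)
have [] := frame_labelling Y1 Y2 Y3 X; rewrite ?[_ :&: X]setIC ?setIA //.
all: try exact: card8.
all: try by apply: card4; rewrite // eq_sym.
move=> s [e1 e2 e3 eX]; exists s.
rewrite /centred_frame /= -!symdiff_blk // -eX -e1 -e2 -e3.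
by rewrite BX BY1 BY2 BY3 !hX.
Qed.

Lemma centred_orbit_profile {B : {set {set 'I_15}}} {X : {set 'I_15}} :
    design_15_8_4 B -> X \in B -> sum_count B X = 14 ->
  [\/ forall Y, Y \in B -> sum_count B Y = 14,
      orbit_profile B counts_C2 weights_C2,
      orbit_profile B counts_C3 weights_C3
    | orbit_profile B counts_C4 weights_C4].
Proof.
move=> hB BX cX; have [s frB] := centred_labelling hB BX cX.
have [||D DC defB] := design_completion s B centred_frame hB _ _ frB.
- by vm_compute.
- by vm_compute.
rewrite defB; case/or4P: (allP centred_completions D DC) => profD.
- by apply: Or41 => Y; apply: linear_design_sum_count.
- by apply: Or42; apply: profile_orbit_profile.
- by apply: Or43; apply: profile_orbit_profile.
- by apply: Or44; apply: profile_orbit_profile.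
Qed.

Lemma subset_cover {T : finType} {P : {set {set T}}} {A : {set T}} :
  A \in P -> A \subset cover P.
Proof. by move=> PA; apply: (bigcup_sup A). Qed.

(** The squares [setX F F] cover all ordered pairs from [A]. *)
Lemma pairwise_cover_card {T : finType} (A : {set T}) (P : {set {set T}}) k :
    {in P, forall F : {set T}, #|F| = k} ->
    {in A &, forall x y, exists2 F, F \in P & (x \in F) && (y \in F)} ->
  #|A| * #|A| <= #|P| * (k * k).
Proof.
move=> cardP coverA; rewrite -cardsX.
have /subset_leq_card/leq_trans : setX A A \subset cover [set setX F F | F in P].
  apply/subsetP=> -[x y] /setXP[Ax Ay].
  have [F PF /andP[Fx Fy]] := coverA x y Ax Ay.
  by apply/bigcupP; exists (setX F F); [apply: imset_f | apply/setXP].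
apply; apply: leq_trans (leq_card_cover _) _.
rewrite (eq_bigr (fun=> k * k)) => [|_ /imsetP[F PF ->]]; last first.
  by rewrite cardsX cardP.
by rewrite sum_nat_const leq_mul2r leq_imset_card orbT.
Qed.

(** All blocks of the common line are centres, since each other block shares a Fano plane with them.
    Two centres exclude the profiles of (C3) and (C4), and a block that is not a centre excludes the
    linear design. *)
Lemma type_C2_sum_counts {B : {set {set 'I_15}}} :
    design_15_8_4 B -> type_C2 B ->
  (exists X X', [/\ X \in B, X' \in B, X != X', sum_count B X = 14
                  & sum_count B X' = 14]) /\
  exists2 Y, Y \in B & sum_count B Y != 14.
Proof.
move=> hB [K [Fs [lineK cardFs FsP defB linesB]]]; have [cardB _ _] := hB.
have FB F : F \in Fs -> F \subset B by rewrite defB; apply: subset_cover.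
have inF Y : Y \in B -> exists2 F, F \in Fs & Y \in F.
  by rewrite defB => /bigcupP[F]; exists F.
split.
  have [F0 Fs0] : exists F, F \in Fs by apply/card_gt0P; rewrite cardFs.
  have KB : K \subset B := subset_trans (FsP F0 Fs0).2 (FB F0 Fs0).
  have centre X : X \in K -> X \in B /\ sum_count B X = 14.
    move=> KX; have BX := subsetP KB X KX; split=> //; apply/(sum_count_eq14 hB BX).
    move=> Y BY ne_YX; have [F FsF FY] := inF Y BY.
    have [[singF _] /subsetP KF] := FsP F FsF.
    apply: (subsetP (FB F FsF)).
    by rewrite (singular_symdiff singF (KF X KX) FY) // eq_sym.
  have [X [Y [KX KY ne_XY]]] : exists X Y, [/\ X \in K, Y \in K & X != Y].
    case/imset2P: lineK => X Y P4X; rewrite inE => /andP[_ P4XY] ->.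
    exists X, Y; rewrite !inE !eqxx orbT; split=> //.
    by apply: contraTneq P4XY => ->; rewrite symdiffv inE cards0.
  have [[BX cX] [BY cY]] := (centre X KX, centre Y KY).
  by exists X, Y.
apply/exists_inP; apply: contraT => /exists_inPn all14.
have cardF : {in Fs, forall F : {set {set 'I_15}}, #|F| = 7}.
  by move=> F /FsP[/card_fano_plane].
(* If all blocks were centres, any two would share a Fano plane, giving 15 * 15 = 225 at most 3 * 49
   = 147. *)
have := pairwise_cover_card B Fs 7 cardF; rewrite cardB cardFs; apply => Y Z BY BZ.
have [<-|ne_ZY] := eqVneq Y Z.
  by have [F FsF FY] := inF Y BY; exists F; rewrite ?FY.
have /(sum_count_eq14 hB BY)/(_ Z BZ) : sum_count B Y = 14.
  by apply/eqP; have := all14 Y BY; rewrite negbK.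
rewrite eq_sym => /(_ ne_ZY) BYZ; have [hL LB] := design_line hB BY BZ BYZ.
have [F FsF /subsetP LF] := (linesB _ hL).1 LB.
by exists F; rewrite ?LF // !inE eqxx ?orbT.
Qed.

(** [Y] lies off the Fano plane, so its lines all pass through [X]; this excludes the linear and
    (C2) cases. [Z] is a further block of the plane and is joined to six others there, which
    excludes (C4). *)
Lemma type_C3_sum_counts {B : {set {set 'I_15}}} :
    design_15_8_4 B -> type_C3 B ->
  exists X Y Z, [/\ X \in B, Y \in B & Z \in B] /\
    [/\ sum_count B X = 14, sum_count B Y <= 2, Z != X & 2 < sum_count B Z].
Proof.
move=> hB [F [X [Ls [[fanoF FX] cardLs LsP defB linesB]]]].
have [cardB _ _] := hB; have [singF _] := fanoF; have cardF := card_fano_plane fanoF.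
have FB : F \subset B by rewrite defB subsetUl.
have LB L : L \in Ls -> L \subset B.
  by move=> LsL; rewrite defB subsetU // subset_cover ?orbT.
have BX := subsetP FB X FX.
have [Z] : exists Z, Z \in F :\ X.
  by apply/card_gt0P; rewrite (card_setD1 F X 6 FX cardF).
rewrite in_setD1 => /andP[ne_ZX FZ].
have /subsetPn[Y BY FY] : ~~ (B \subset F).
  by apply/negP=> /subset_leq_card; rewrite cardB cardF.
exists X, Y, Z; split; first by rewrite BX BY (subsetP FB).
split=> //.
- apply/(sum_count_eq14 hB BX) => W; rewrite {1}defB => /setUP[FW|] ne_WX.
    by apply/(subsetP FB)/(singular_symdiff singF); rewrite // eq_sym.
  case/bigcupP: ne_WX => L LsL LW; have [lineL LX] := LsP L LsL => ne_WX.
  by apply/(subsetP (LB L LsL))/(P4_line_symdiff lineL); rewrite // eq_sym.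
- apply: (sum_count_le2 (X := X) hB BY) => [|L lineL LsubB LY].
    by apply: contraNneq FY => ->.
  have [/subsetP/(_ Y LY)|/LsP[]//] := (linesB L lineL).1 LsubB.
  by rewrite (negPf FY).
apply: leq_trans (_ : #|F :\ Z| <= _); first by rewrite (card_setD1 F Z 6 FZ cardF).
apply: subset_leq_card; apply/subsetP=> W; rewrite in_setD1 inE => /andP[ne_WZ FW].
rewrite (subsetP FB) //= (subsetP FB) // (singular_symdiff singF) // eq_sym //.
Qed.

Lemma type_C4_sum_counts {B : {set {set 'I_15}}} :
    design_15_8_4 B -> type_C4 B ->
  exists X, [/\ X \in B, sum_count B X = 14
              & forall Y, Y \in B -> Y != X -> sum_count B Y <= 2].
Proof.
move=> hB [X [Ls [cardLs LsP defB linesB]]].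
have LB L : L \in Ls -> L \subset B by rewrite defB; apply: subset_cover.
have [L0 Ls0] : exists L, L \in Ls by apply/card_gt0P; rewrite cardLs.
have BX := subsetP (LB L0 Ls0) X (LsP L0 Ls0).2.
exists X; split=> //.
  apply/(sum_count_eq14 hB BX) => W; rewrite {1}defB => /bigcupP[L LsL LW] ne_WX.
  have [lineL LX] := LsP L LsL.
  by apply/(subsetP (LB L LsL))/(P4_line_symdiff lineL); rewrite // eq_sym.
move=> Y BY ne_YX; apply: (sum_count_le2 hB BY ne_YX) => L lineL LsubB _.
by have /LsP[] := (linesB L lineL).1 LsubB.
Qed.

(** Three non-collinear members of [F] together with [X] form a basis of a singular subspace, where
    closure under sums forces every intersection size asked for by [frame_labelling]. *)
Lemma affine_labelling {M F : {set {set 'I_15}}} {X : {set 'I_15}} :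
    singular P4 M -> singular P4 F -> #|F| = 7 -> F \subset M -> X \in M :\: F ->
  exists s, all (fun b => blk s b \in F) fano_frame /\
            all (fun b => blk s b \in M :\: F) affine_frame.
Proof.
move=> singM singF cardF /subsetP FM /setDP[MX FX].
have avoid (A : {set {set 'I_15}}) : #|A| < 7 -> exists2 Y, Y \in F & Y \notin A.
  move=> ltA; apply/subsetPn; apply: contraL ltA => /subset_leq_card.
  by rewrite cardF -leqNgt.
have [Y1 F1 _] := avoid set0 ltac:(by rewrite cards0).
have [Y2 F2] := avoid [set Y1] ltac:(by rewrite cards1).
rewrite inE => n21.
have F12 : symdiff Y1 Y2 \in F by rewrite (singular_symdiff singF) // eq_sym.
have [Y3 F3] : exists2 Y, Y \in F & Y \notin [set Y1; Y2; symdiff Y1 Y2].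
  by apply: avoid; apply: leq_ltn_trans (leq_card_set3 _ _ _) _.
rewrite !inE !negb_or => /andP[/andP[n31 n32] n312].
have triple Y Z W : Y \in M -> Z \in M -> W \in M -> Z != Y -> W != Y -> W != Z ->
    W != symdiff Y Z -> #|Y :&: Z :&: W| = 2.
  move=> MY MZ MW nZY nWY nWZ nWYZ; apply: (card_setI_half 4).
  - by rewrite (singular_cardI singM) // eq_sym.
  - by rewrite (singular_cardI singM) // eq_sym.
  - by rewrite (singular_cardI singM) // (singular_symdiff singM) // eq_sym.
have nXF Y : Y \in F -> X != Y by move=> FY; apply: contraNneq FX => ->.
have [M1 M2 M3] : [/\ Y1 \in M, Y2 \in M & Y3 \in M] by rewrite !FM.
have F13 : symdiff Y1 Y3 \in F by rewrite (singular_symdiff singF) // eq_sym.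
have F23 : symdiff Y2 Y3 \in F by rewrite (singular_symdiff singF) // eq_sym.
have c123 := triple _ _ _ M1 M2 M3 n21 n31 n32 n312.
have c12X := triple _ _ _ M1 M2 MX n21 (nXF _ F1) (nXF _ F2) (nXF _ F12).
have c13X := triple _ _ _ M1 M3 MX n31 (nXF _ F1) (nXF _ F3) (nXF _ F13).
have c23X := triple _ _ _ M2 M3 MX n32 (nXF _ F2) (nXF _ F3) (nXF _ F23).
have c123X : #|Y1 :&: Y2 :&: Y3 :&: X| = 1.
  (* Each of [Y1], [Y2] and their sum meets [Y3 :&: X] in 2 points, so the fourfold intersection has
     half of that. *)
  rewrite -setIA; apply: (card_setI_half 2); rewrite ?setIA //.
  rewrite setIC setIA triple ?(FM _ F12) ?nXF //.
  by rewrite (singular_symdiff singF) // eq_sym.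
have [] := frame_labelling Y1 Y2 Y3 X => //.
all: try by apply: (singular_card singM).
all: try by apply: (singular_cardI singM); rewrite // eq_sym // nXF.
move=> s [e1 e2 e3 eX]; exists s.
have closedF b c : size b = 15 -> size c = 15 -> b != c -> blk s b \in F ->
    blk s c \in F -> blk s (xor b c) \in F.
  move=> sz_b sz_c ne_bc Fb Fc; rewrite -symdiff_blk //.
  by rewrite (singular_symdiff singF) //; apply: contraNneq ne_bc => /blk_inj->.
have inF : all (fun b => blk s b \in F) fano_frame.
  move: F1 F2 F3; rewrite e1 e2 e3 => F1 F2 F3.
  by rewrite /= F1 F2 F3 !closedF.
split=> //; rewrite /affine_frame; apply/allP=> b; rewrite inE.
case/predU1P=> [-> | /mapP[c fr_c ->]]; first by rewrite -eX inE FX.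
have Fc := allP inF c fr_c.
have sz_c : size c = 15.
  have /allP/(_ c fr_c)/eqP // : all (fun b => size b == 15) fano_frame.
  by vm_compute.
(* The sum of [X] with a member of [F] stays outside [F], as otherwise adding that member again
   would put [X] in [F]. *)
rewrite -symdiff_blk // -eX inE (singular_symdiff singM MX (FM _ Fc) (nXF _ Fc)).
rewrite andbT; apply: contra FX => FXc.
rewrite -[X](symdiffKr X (blk s c)) (singular_symdiff singF) //.
rewrite symdiffC symdiff_eq symdiffv; apply: contraTneq MX => ->.
by apply/negP=> /(singular_card singM); rewrite cards0.
Qed.

Lemma type_NC_orbit_profile {B : {set {set 'I_15}}} :
    design_15_8_4 B -> type_NC B ->
  orbit_profile B counts_NC weights_NC.
Proof.
move=> hB [M [F [F' [[singM _] [fanoF FM] [fanoF' disjF'M] defB _]]]].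
have [cardB _ _] := hB; have [singF _] := fanoF.
have [X MFX] : exists X, X \in M :\: F.
  have [XB|] := set_0Vmem (M :\: F); last by case=> X; exists X.
  by move: cardB; rewrite defB XB set0U (card_fano_plane fanoF').
have [s [frF frMF]] := affine_labelling singM singF (card_fano_plane fanoF) FM MFX.
have frB : all (fun b => blk s b \in B) affine_frame.
  by apply: sub_all frMF => b; rewrite defB in_setU => ->.
have [||D DC defD] := design_completion s B affine_frame hB _ _ frB.
- by vm_compute.
- by vm_compute.
have /orP[/hasP[b fr_b Db]|profD] := allP affine_completions D DC; last first.
  by rewrite defD; apply: profile_orbit_profile.
have := allP frF b fr_b; have : blk s b \in B.
  by rewrite defD inE; apply/mapP; exists b.
(* A block in [F] contradicts both parts of [B]: [M :\: F] omits [F], and [F'] is disjoint from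
   [M]. *)
rewrite defB in_setU in_setD => /orP[/andP[/negPf-> //]|F'b Fb].
by have := disjointFr disjF'M F'b; rewrite (subsetP FM).
Qed.

Theorem proposition14 (B : {set {set 'I_15}}) (hB : design_15_8_4 B) :
  [/\ type_C2 B ->
        two_orbits 'P%act (design_aut B) [set: 'I_15] 3 12 /\
        two_orbits 'P^*%act (design_aut B) B 3 12,
      type_C3 B ->
        fixed_and_two_orbits 'P%act (design_aut B) [set: 'I_15] 6 8 /\
        fixed_and_two_orbits 'P^*%act (design_aut B) B 6 8,
      type_C4 B ->
        two_orbits 'P%act (design_aut B) [set: 'I_15] 7 8 /\
        fixed_and_transitive 'P^*%act (design_aut B) B
    & type_NC B ->
        fixed_and_transitive 'P%act (design_aut B) [set: 'I_15] /\
        two_orbits 'P^*%act (design_aut B) B 7 8].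
Proof.
split=> typeB.
- have [[X [X' [BX BX' ne_XX' cX cX']]] [Y BY cY]] := type_C2_sum_counts hB typeB.
  (* The lists [counts_C3] and [counts_C4] contain 14 exactly once, against the two centres [X] and
     [X']. *)
  have unique14 vs : level_orbits 'P^*%act (design_aut B) B (sum_count B) vs ->
      count_mem 14 vs != 1.
    move/(card_level 14) => <-; apply/cards1P=> -[Z /setP eqZ].
    have := eqZ X; have := eqZ X'; rewrite !inE BX BX' cX cX' /= => /esym/eqP eX'.
    by move/esym/eqP=> eX; rewrite eX eX' eqxx in ne_XX'.
  case: (centred_orbit_profile hB BX cX) => [all14|[pt bl]|[_ bl]|[_ bl]].
  + by rewrite all14 in cY.
  + by split; [apply: level_two_orbits pt | apply: level_two_orbits bl].
  + by have := unique14 _ bl.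
  + by have := unique14 _ bl.
- have [X [Y [Z [[BX BY BZ] [cX cY ne_ZX cZ]]]]] := type_C3_sum_counts hB typeB.
  case: (centred_orbit_profile hB BX cX) => [all14|[_ bl]|[pt bl]|[_ bl]].
  + by rewrite all14 in cY.
  + have := level_mem bl BY; rewrite mem_cat !mem_nseq.
    by case/orP=> /eqP eY; rewrite eY in cY.
  + split; first exact: level_fixed_and_two_orbits pt.
    exact: level_fixed_and_two_orbits bl.
  have := level_mem bl BZ; rewrite inE mem_nseq => /orP[]/eqP eZ; last first.
    by rewrite eZ in cZ.
  have /cards1P[W /setP eqW] : #|[set U in B | sum_count B U == 14]| == 1.
    by rewrite (card_level 14 bl).
  have := eqW X; have := eqW Z; rewrite !inE BX BZ cX eZ /= => /esym/eqP eZ'.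
  by move/esym/eqP=> eX; rewrite eX eZ' eqxx in ne_ZX.
- have [X [BX cX cY]] := type_C4_sum_counts hB typeB; have [cardB _ _] := hB.
  have [Y] : exists Y, Y \in B :\ X.
    by apply/card_gt0P; rewrite (card_setD1 B X 14 BX cardB).
  rewrite in_setD1 => /andP[ne_YX BY]; have cYY := cY Y BY ne_YX.
  case: (centred_orbit_profile hB BX cX) => [all14|[_ bl]|[_ bl]|[pt bl]].
  + by rewrite all14 in cYY.
  + have := level_mem bl BY; rewrite mem_cat !mem_nseq.
    by case/orP=> /eqP eY; rewrite eY in cYY.
  (* The (C3) profile has a block of value 6, while here every block other than [X] has value at
     most 2. *)
  + have [|Z BZ cZ] := level_onto (v := 6) bl; first by [].
    have := cY Z BZ; rewrite cZ => /(_ _)/negP[] //.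
    by apply: contra_eq_neq cZ => ->; rewrite cX.
  split; first exact: level_two_orbits pt.
  exact: level_fixed_and_transitive bl.
have [pt bl] := type_NC_orbit_profile hB typeB.
split; first exact: level_fixed_and_transitive pt.
exact: level_two_orbits bl.
Qed.
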